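(* Let $1<p\le2$. Let $L,R$ be non-negative random variables such that $\mathbb{P}\{L>0\}+\mathbb{P}\{R>0\}>1$, $\mathbb{E}[L+R]=1$ and $\mathbb{E}[L^p+R^p]<1$. Let $\bar\mu_0$ be a Borel probability measure on $\mathbb{R}$ whose distribution function $F_0$ satisfies $$\lim_{x\to-\infty}|x|F_0(x)=\lim_{x\to+\infty}x[1-F_0(x)]=c_0\in[0,+\infty),\qquad \lim_{\rho\to+\infty}\int_{(-\rho,\rho)}x\,dF_0(x)=\gamma_0$$ with $-\infty<\gamma_0<+\infty$. Let $(\mu_t)_{t\ge0}$ be the solution of the kinetic equation with initial datum $\bar\mu_0$ and $\mu_\infty$ the corresponding steady state. If $d_p(\bar\mu_0,\mu_\infty)<+\infty$, then $$d_p(\mu_t,\mu_\infty)\le C_p\,e^{-t|\varphi(p)|}\qquad(t\ge0)$$ for a suitable constant $C_p=C_p(\bar\mu_0)<+\infty$.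
   Context: Notation: $\varphi(q)=\frac{1}{q}\big(\mathbb{E}[L^q+R^q]-1\big)$ for $q>0$. Solution: given a Borel probability measure $\bar\mu_0$ on $\mathbb{R}$, the solution of the kinetic equation with initial datum $\bar\mu_0$ is the unique family $(\mu_t)_{t\ge0}$ of probability measures on $\mathbb{R}$ whose Fourier–Stieltjes transforms $\hat\mu_t(\xi)=\int e^{i\xi v}\mu_t(dv)$ satisfy $\partial_t\hat\mu_t(\xi)+\hat\mu_t(\xi)=\mathbb{E}[\hat\mu_t(L\xi)\hat\mu_t(R\xi)]$ for $t>0$, $\xi\in\mathbb{R}$, with $\hat\mu_0(\xi)=\int e^{i\xi v}\bar\mu_0(dv)$. Equivalently $\mu_t=\sum_{n\ge0}e^{-t}(1-e^{-t})^n\rho_n$, where $\rho_0=\bar\mu_0$ and, for $n\ge1$, $\rho_n=\frac1n\sum_{j=0}^{n-1}Q^+(\rho_j,\rho_{n-1-j})$, $Q^+(\mu,\nu)$ being the law of $LX+RY$ with $X\sim\mu$, $Y\sim\nu$ and $X,Y,(L,R)$ independent. Mixing measure: $\nu_1$ is the unique probability measure on $[0,+\infty)$ with $\int v\,\nu_1(dv)=1$ whose Fourier–Stieltjes transform satisfies $\hat\nu_1(\xi)=\mathbb{E}[\hat\nu_1(L\xi)\hat\nu_1(R\xi)]$ for all $\xi\in\mathbb{R}$. Steady state: $\mu_\infty$ is the probability measure on $\mathbb{R}$ (the weak limit of $\mu_t$ as $t\to+\infty$) with $\int e^{i\xi v}\mu_\infty(dv)=\int_{[0,+\infty)}e^{m(i\gamma_0\xi-c_0\pi|\xi|)}\nu_1(dm)$.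 Wasserstein distance of order $p>0$: $d_p(\mu_1,\mu_2)=\inf_m\big(\int_{\mathbb{R}^2}|x-y|^p m(dx\,dy)\big)^{\min(1,1/p)}$, the infimum being over all couplings $m$ of $\mu_1,\mu_2$; it may be $+\infty$. *)

(* Defs.v *)
From HB Require Import structures.
From mathcomp Require Import all_boot all_order all_algebra.
From mathcomp Require Import all_classical all_reals all_analysis.
From mathcomp Require Import complex.
Set Implicit Arguments.
Unset Strict Implicit.
Unset Printing Implicit Defensive.
Import Order.TTheory GRing.Theory Num.Theory.
Import numFieldNormedType.Exports.
Local Open Scope classical_set_scope.
Local Open Scope ring_scope.

Definition Cexp (R : realType) (z : R[i]) : R[i] :=
  Complex (expR (complex.Re z) * cos (complex.Im z))
          (expR (complex.Re z) * sin (complex.Im z)).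

Definition Cintegral d (T : measurableType d) (R : realType)
    (mu : {measure set T -> \bar R}) (D : set T) (f : T -> R[i]) : R[i] :=
  Complex (\int[mu]_(x in D) complex.Re (f x))
          (\int[mu]_(x in D) complex.Im (f x)).

Definition Cexpectation d (T : measurableType d) (R : realType)
    (P : probability T R) (Z : T -> R[i]) : R[i] := Cintegral P setT Z.

(* Limits and derivatives of C-valued functions of a real variable are taken
   on real and imaginary parts: [R[i]] is not a normed module over [R]. *)
Definition Ccvg_at_right (R : realType) (f : R -> R[i]) (a : R) (z : R[i]) :=
  (complex.Re (f t) @[t --> a^'+] --> complex.Re z) /\
  (complex.Im (f t) @[t --> a^'+] --> complex.Im z).

Definition is_Cderive (R : realType) (f : R -> R[i]) (t : R) (z : R[i]) :=
  is_derive t (1 : R) (fun s => complex.Re (f s)) (complex.Re z) /\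
  is_derive t (1 : R) (fun s => complex.Im (f s)) (complex.Im z).

Definition fourier_stieltjes (R : realType) (mu : probability R R) (xi : R) :
    R[i] :=
  Cintegral mu setT (fun v : R => Cexp (Complex 0 (xi * v))).

Definition distribution_function (R : realType) (mu : probability R R) (x : R) :
    R :=
  fine (mu `]-oo, x]%classic).

Definition spectral_function d (T : measurableType d) (R : realType)
    (P : probability T R) (L M : {RV P >-> R}) (q : R) : \bar R :=
  ((q^-1)%:E * ('E_P[(fun w => L w `^ q + M w `^ q)%R] - 1))%E.

(* Only the values of [mu] at nonnegative times are constrained. Right
   continuity at time 0 is what links the equation, which holds for positive
   times only, to the initial datum; without it uniqueness fails. *)
Definition kinetic_solution d (T : measurableType d) (R : realType)
    (P : probability T R) (L M : {RV P >-> R}) (mu0 : probability R R)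
    (mu : R -> probability R R) : Prop :=
  [/\ forall t xi : R, 0 < t ->
        is_Cderive (fun s => fourier_stieltjes (mu s) xi) t
          (Cexpectation P (fun w => fourier_stieltjes (mu t) (L w * xi) *
                                    fourier_stieltjes (mu t) (M w * xi))
           - fourier_stieltjes (mu t) xi),
      forall xi : R, Ccvg_at_right (fun s => fourier_stieltjes (mu s) xi) 0
                       (fourier_stieltjes mu0 xi) &
      forall xi : R, fourier_stieltjes (mu 0) xi = fourier_stieltjes mu0 xi].

Definition mixing_measure d (T : measurableType d) (R : realType)
    (P : probability T R) (L M : {RV P >-> R}) (nu : probability R R) : Prop :=
  [/\ nu `]-oo, (0 : R)[%classic = 0%E,
      (\int[nu]_(v in `[(0%R : R), +oo[%classic) v%:E = 1)%E &
      forall xi : R, fourier_stieltjes nu xi =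
        Cexpectation P (fun w => fourier_stieltjes nu (L w * xi) *
                                 fourier_stieltjes nu (M w * xi))].

Definition steady_state (R : realType) (nu : probability R R) (c0 gamma0 : R)
    (mu : probability R R) : Prop :=
  forall xi : R, fourier_stieltjes mu xi =
    Cintegral nu `[(0 : R), +oo[
      (fun m : R => Cexp (Complex (- (m * (c0 * pi * `|xi|)))
                                  (m * (gamma0 * xi)))).

(* Marginals are compared on measurable sets only: the value of a [probability]
   on a nonmeasurable set is irrelevant. *)
Definition coupling (R : realType) (mu1 mu2 : probability R R)
    (m : probability (R * R)%type R) : Prop :=
  forall A : set R, measurable A ->
    m (fst @^-1` A) = mu1 A /\ m (snd @^-1` A) = mu2 A.

Definition wasserstein (R : realType) (p : R) (mu1 mu2 : probability R R) :
    \bar R :=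
  ereal_inf [set ((\int[m]_z (`|z.1 - z.2| `^ p)%:E) `^ (Num.min 1 p^-1)%R)%E
            | m in [set m | coupling mu1 mu2 m]].

(* Main.v *)
Require Import Defs.
From HB Require Import structures.
From mathcomp Require Import all_boot all_order all_algebra.
From mathcomp Require Import all_classical all_reals all_analysis.
From mathcomp Require Import measurable_realfun complex ring lra.
Import Order.TTheory GRing.Theory Num.Theory.
Import numFieldNormedType.Exports.
Set Implicit Arguments. Unset Strict Implicit. Unset Printing Implicit Defensive.
Local Open Scope classical_set_scope.
Local Open Scope ring_scope.

(** Why the estimate holds. A coupling of the initial datum with the steady
    state can be transported along the collision dynamics, both copies using
    the same weights [L] and [M]; its cost then contracts at the announced
    rate, because the difference of the two coordinates collides like a sample
    of the line.

    The coupling at time [t] ([coupling_flow]) is the Wild sum, with weights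
    [e^-t (1 - e^-t)^n], of the laws on the plane obtained from the initial
    coupling by iterated collisions. Its coordinates have the right laws
    because the Wild sums approximate every solution of the equation for the
    transforms, with remainder at most [(1 - e^-t)^N] ([wild_partial_close]),
    and because a Fourier transform determines its law
    ([fourier_stieltjes_inj]). The steady state is a fixed point of the
    collision operator ([steady_collision]), hence is itself a constant
    solution, and the same statement identifies the second coordinate.

    The cost is controlled by an additive quantity instead of the p-th moment
    of the difference [X - V] itself: the supremum over [x] of
    [E |x + X - V|^p - |x|^p] ([moment_excess]). A collision maps the bounds
    [A], [A'] to [E[L^p] A + E[M^p] A'], with no multiplicative constant, and a
    mixture averages them, so that, with [S = E[L^p + M^p]], the flow at time
    [t] has the bound [A e^(-t (1 - S))] ([sum_geometric_wild_moment]). For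
    [1 < p <= 2] the excess is finite as soon as the p-th moment is and
    [X - V] is centred ([moment_excess_centered]).

    That [X - V] is centred ([coupling_centered]) is where the hypotheses on
    the tails enter. Neither coordinate need have a mean, but
    [E[sin (xi X)] / xi] and [E[sin (xi V)] / xi] both tend to [gamma0] when
    [xi] vanishes: the first because the two tails balance
    ([sine_mean_estimate]), the second by the explicit transform of the steady
    state and the unit mean of the mixing measure ([steady_sine_mean]). As
    [X - V] is integrable, dominated convergence gives the claim. *)

(** * Bounded measurable functions and their integrals *)

(** Bounded integrands are integrable for every finite measure, which makes the
    integrability conditions depend on the integrand only. *)
Definition bounded_measurable d (T : measurableType d) (R : realType)
    (f : T -> R) : Prop :=
  measurable_fun setT f /\ exists C : R, forall x, `|f x| <= C.

Section bounded_measurable_theory.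
Context d (T : measurableType d) (R : realType).
Implicit Types (f g : T -> R).

Lemma bounded_measurable_cst (c : R) : bounded_measurable (fun _ : T => c).
Proof. by split; [exact: measurable_cst|exists `|c|]. Qed.

Lemma bounded_measurableD f g : bounded_measurable f -> bounded_measurable g ->
  bounded_measurable (fun x => f x + g x).
Proof.
move=> [mf [A fA]] [mg [B gB]]; split; first exact: measurable_funD.
by exists (A + B) => x; rewrite (le_trans (ler_normD _ _))// lerD.
Qed.

Lemma bounded_measurableN f : bounded_measurable f ->
  bounded_measurable (fun x => - f x).
Proof.
move=> [mf [A fA]]; split; first exact: measurableT_comp.
by exists A => x; rewrite normrN.
Qed.

Lemma bounded_measurableB f g : bounded_measurable f -> bounded_measurable g ->
  bounded_measurable (fun x => f x - g x).
Proof.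
by move=> bf bg; apply: bounded_measurableD => //; exact: bounded_measurableN.
Qed.

Lemma bounded_measurableM f g : bounded_measurable f -> bounded_measurable g ->
  bounded_measurable (fun x => f x * g x).
Proof.
move=> [mf [A fA]] [mg [B gB]]; split; first exact: measurable_funM.
by exists (A * B) => x; rewrite normrM ler_pM.
Qed.

Lemma bounded_measurable_comp d' (T' : measurableType d') (h : T' -> T) f :
  measurable_fun setT h -> bounded_measurable f ->
  bounded_measurable (fun x => f (h x)).
Proof.
move=> mh [mf [A fA]]; split; first exact: measurableT_comp.
by exists A.
Qed.

Lemma bounded_measurable_integrable (m : {finite_measure set T -> \bar R}) f :
  bounded_measurable f -> m.-integrable setT (EFin \o f).
Proof.
move=> [mf [A fA]]; apply: measurable_bounded_integrable => //.
  by rewrite ltey_eq fin_num_measure.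
exists A; split; first exact: num_real.
by move=> B AB x _; exact: le_trans (fA x) (ltW AB).
Qed.

Lemma le_Rintegral_bounded (P : probability T R) f (c : R) :
  measurable_fun setT f -> (forall x, `|f x| <= c) ->
  `|\int[P]_x f x| <= c.
Proof.
move=> mf fc.
have bf : bounded_measurable f by split => //; exists c.
have iN : P.-integrable setT (EFin \o (fun x => `|f x|)).
  apply: bounded_measurable_integrable; split; first exact: measurableT_comp.
  by exists c => x; rewrite normr_id.
apply: (le_trans (le_normr_Rintegral measurableT _)).
  exact: bounded_measurable_integrable.
apply: (@le_trans _ _ (\int[P]_(x in setT) c)).
  apply: le_Rintegral => //.
  exact: (bounded_measurable_integrable _ (bounded_measurable_cst c)).
rewrite Rintegral_cst// [X in fine X](_ : _ = 1%E); first by rewrite mulr1.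
exact: probability_setT.
Qed.

End bounded_measurable_theory.
Arguments bounded_measurable_cst {d T R} c.

Definition image_probability d d' (T : measurableType d)
    (T' : measurableType d') (R : realType) (P : probability T R) (h : T -> T')
    (mh : measurable_fun setT h) : probability T' R :=
  distribution P (mfun_Sub (mem_set mh)).

Section image_probability_theory.
Context d d' (T : measurableType d) (T' : measurableType d') (R : realType).
Variables (P : probability T R) (h : T -> T') (mh : measurable_fun setT h).

Lemma image_probabilityE A : image_probability P mh A = P (h @^-1` A).
Proof. by []. Qed.

Lemma ge0_integral_image (f : T' -> \bar R) :
  measurable_fun setT f -> (forall y, 0 <= f y)%E ->
  (\int[image_probability P mh]_y f y = \int[P]_x f (h x))%E.
Proof. by move=> mf f0; rewrite ge0_integral_distribution. Qed.

Lemma Rintegral_image (f : T' -> R) : bounded_measurable f ->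
  \int[image_probability P mh]_y f y = \int[P]_x f (h x).
Proof.
move=> bf; rewrite /Rintegral integral_distribution//.
- by apply/measurable_EFinP; case: bf.
- apply: (bounded_measurable_integrable P (f := f \o h)).
  exact: bounded_measurable_comp.
Qed.

End image_probability_theory.

Section bounded_fubini.
Context d1 d2 (T1 : measurableType d1) (T2 : measurableType d2) (R : realType).
Variables (m1 : {finite_measure set T1 -> \bar R}).
Variables (m2 : {finite_measure set T2 -> \bar R}).
Variable f : T1 * T2 -> R.
Hypothesis bf : bounded_measurable f.

Lemma bounded_measurable_integrable_prod :
  (m1 \x m2)%E.-integrable setT (EFin \o f).
Proof.
case: bf => mf [C fC]; apply/integrableP; split; first exact/measurable_EFinP.
have mN : measurable_fun setT (fun z => `|(f z)%:E|%E).
  by apply: measurableT_comp => //; exact/measurable_EFinP.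
rewrite [ltLHS](fubini_tonelli1 _ mN)//.
apply: (@le_lt_trans _ _ (\int[m1]_(x in setT) (C%:E * m2 setT))%E).
  apply: ge0_le_integral => //.
  - by move=> x _; apply: integral_ge0.
  - exact: (measurable_fun_fubini_tonelli_F _ mN).
  - move=> x _; rewrite -integral_cst//; apply: ge0_le_integral => //.
    + by apply: (measurableT_comp mN); exact: measurable_pair1.
    + by move=> y _; rewrite lee_fin fC.
rewrite integral_cst//.
have m2F : m2 setT \is a fin_num by exact: fin_num_measure.
have m1F : m1 setT \is a fin_num by exact: fin_num_measure.
by rewrite ltey_eq !fin_numM.
Qed.

Lemma bounded_measurable_Rintegral1 :
  bounded_measurable (fun x => \int[m2]_y f (x, y)).
Proof.
case: (bf) => mf [C fC]; split.
  have := measurable_fubini_F bounded_measurable_integrable_prod.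
  by move=> mF; apply: measurableT_comp mF.
exists (C * fine (m2 setT)) => x.
have mfx : measurable_fun setT (fun y => f (x, y)).
  by apply: measurableT_comp mf _; exact: measurable_pair1.
apply: (le_trans (le_normr_Rintegral measurableT _)).
  by apply: bounded_measurable_integrable; split => //; exists C.
rewrite -Rintegral_cst//; apply: le_Rintegral => //.
- apply: bounded_measurable_integrable; split; first exact: measurableT_comp.
  by exists C => y; rewrite normr_id.
- by apply: bounded_measurable_integrable; exact: bounded_measurable_cst.
Qed.

Lemma Rintegral_prod : \int[(m1 \x m2)%E]_z f z =
  \int[m1]_x \int[m2]_y f (x, y).
Proof.
rewrite /Rintegral -(integral12_prod_meas1 bounded_measurable_integrable_prod).
congr fine; apply: eq_integral => x _; rewrite /fubini_F fineK//.
apply: (@integrable_fin_num _ _ _ m2) => //.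
apply: (bounded_measurable_integrable m2 (f := fun y => f (x, y))).
by apply: (bounded_measurable_comp (h := fun y => (x, y))) bf; exact: measurable_pair1.
Qed.

End bounded_fubini.

Lemma bounded_measurable_swap d1 d2 (T1 : measurableType d1)
    (T2 : measurableType d2) (R : realType) (f : T1 * T2 -> R) :
  bounded_measurable f -> bounded_measurable (fun z => f (z.2, z.1)).
Proof.
move=> bf; apply: (bounded_measurable_comp (h := fun z => (z.2, z.1))) bf.
exact: measurable_fun_pair.
Qed.

Section fubini_itv.
Context d (T : measurableType d) (R : realType).
Variables (P : {finite_measure set T -> \bar R}) (a b : R) (f : T * R -> R).
Hypothesis bf : bounded_measurable f.

Let D : set R := `[a, b]%classic.

Let mD : measurable D. Proof. exact: measurable_itv. Qed.

Let g (z : T * R) := f z * \1_D z.2.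

Let mg : measurable_fun setT g.
Proof.
by case: bf => mf _; apply: measurable_funM => //; exact: measurableT_comp.
Qed.

Let gE x y : ((f \o pair x) \_ D) y = g (x, y).
Proof.
by rewrite patchE /g indicE; case: ifPn => _ /=; rewrite ?mulr1 ?mulr0.
Qed.

Let gb : exists C, forall z, `|g z| <= C * \1_D z.2.
Proof.
case: bf => _ [C fC]; exists C => z.
by rewrite normrM ler_pM// indicE normr_nat.
Qed.

Let integrable_bound C : lebesgue_measure.-integrable setT
  (fun y : R => (C * \1_D y)%:E).
Proof.
under eq_fun do rewrite EFinM.
have i2 := integrableZl measurableT C (@integrable_indic_itv R a b true false).
exact i2.
Qed.

Let integrable_section x :
  lebesgue_measure.-integrable setT (EFin \o (fun y => g (x, y))).
Proof.
case: gb => C gC; apply: le_integrable (integrable_bound C) => //.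
  apply/measurable_EFinP; apply: measurableT_comp mg _.
  exact: measurable_pair1.
by move=> y _ /=; rewrite lee_fin (le_trans (gC _))// ler_norm.
Qed.

Let integrable_g :
  (P \x lebesgue_measure)%E.-integrable setT (EFin \o g).
Proof.
apply/integrableP; split; first exact/measurable_EFinP.
have mN : measurable_fun setT (fun z => `|(g z)%:E|%E).
  by apply: measurableT_comp => //; exact/measurable_EFinP.
have -> := @fubini_tonelli1 _ _ _ _ _ P (@lebesgue_measure R) _ mN
  (fun=> abse_ge0 _).
case: gb => C gC.
apply: (@le_lt_trans _ _
    (\int[P]_(x in setT) (\int[lebesgue_measure]_y (C * \1_D y)%:E)))%E.
  apply: ge0_le_integral => //.
  - by move=> x _; apply: integral_ge0.
  - exact (@measurable_fun_fubini_tonelli_F _ _ _ _ _ (@lebesgue_measure R)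
      _ mN (fun=> abse_ge0 _)).
  - move=> x _; apply: ge0_le_integral => //.
    + by apply: (measurableT_comp mN); exact: measurable_pair1.
    + by case/integrableP : (integrable_bound C).
    + by move=> y _; rewrite lee_fin; exact: gC (x, y).
rewrite integral_cst// ltey_eq fin_numM//; last exact: fin_num_measure.
exact: integrable_fin_num (integrable_bound C).
Qed.

Let innerE x : \int[lebesgue_measure]_(y in D) f (x, y) =
  fine (fubini_F lebesgue_measure (EFin \o g) x).
Proof.
rewrite Rintegral_mkcond; congr fine; apply: eq_integral => y _.
by rewrite gE.
Qed.

Lemma bounded_measurable_Rintegral_itv :
  bounded_measurable (fun x => \int[lebesgue_measure]_(y in `[a, b]) f (x, y)).
Proof.
split.
  under eq_fun do rewrite innerE.
  exact: measurableT_comp (measurable_fubini_F integrable_g).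
case: gb => C gC; exists (\int[lebesgue_measure]_y (C * \1_D y)) => x.
rewrite innerE -[fine _]/(\int[lebesgue_measure]_y g (x, y)).
apply: le_trans (le_normr_Rintegral measurableT (integrable_section x)) _.
have ia : lebesgue_measure.-integrable setT
    (EFin \o (fun y => `|g (x, y)|)) by exact: integrable_norm.
apply: (le_Rintegral measurableT ia (integrable_bound C)) => y _.
exact: gC (x, y).
Qed.

(** The second measure is infinite: the integrand is first cut off outside the
    interval, which makes it integrable for the product measure. *)
Lemma Rintegral_fubini_itv :
  \int[P]_x \int[lebesgue_measure]_(y in `[a, b]) f (x, y) =
  \int[lebesgue_measure]_(y in `[a, b]) \int[P]_x f (x, y).
Proof.
transitivity (fine (\int[P]_x \int[lebesgue_measure]_y (g (x, y))%:E)%E).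
  congr fine; apply: eq_integral => x _; rewrite innerE fineK//.
  exact: integrable_fin_num (integrable_section x).
have -> := @Fubini _ _ _ _ _ P (@lebesgue_measure R) _ integrable_g.
rewrite Rintegral_mkcond; congr fine; apply: eq_integral => y _.
rewrite patchE; case: ifPn => yD.
  rewrite fineK; last first.
    apply: (@integrable_fin_num _ _ _ P) => //.
    apply: (bounded_measurable_integrable P (f := fun x => f (x, y))).
    by apply: (bounded_measurable_comp (h := fun x => (x, y))) bf;
      exact: measurable_pair2.
  by apply: eq_integral => x _; rewrite /g/= indicE yD mulr1.
under eq_integral do rewrite /g/= indicE (negbTE yD) mulr0.
by rewrite integral0.
Qed.

End fubini_itv.

(** * Recovering a probability measure from its Fourier transform *)

Lemma Rintegral_derivative (R : realType) (f F : R -> R) (a b : R) :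
  a <= b -> continuous f -> (forall x, is_derive x (1 : R) F (f x)) ->
  \int[lebesgue_measure]_(x in `[a, b]) f x = F b - F a.
Proof.
move=> + cf dF; rewrite le_eqVlt => /predU1P[<-|ab].
  by rewrite set_itv1 Rintegral_set1 subrr.
have cF x : F y @[y --> x] --> F x.
  by apply: differentiable_continuous; apply/derivable1_diffP; case: (dF x).
rewrite /Rintegral (continuous_FTC2 (F := F) ab)//.
- exact: continuous_subspaceT.
- split.
  + by move=> x _; case: (dF x).
  + exact: cvg_at_right_filter.
  + exact: cvg_at_left_filter.
- by move=> x _; rewrite derive1E; case: (dF x).
Qed.

Section fourier_re_im.
Context (R : realType) (mu : probability R R).

Lemma Re_fourier_stieltjes xi :
  complex.Re (fourier_stieltjes mu xi) = \int[mu]_v cos (xi * v).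
Proof.
by rewrite /=; apply: eq_Rintegral => v _; rewrite expR0 mul1r.
Qed.

Lemma Im_fourier_stieltjes xi :
  complex.Im (fourier_stieltjes mu xi) = \int[mu]_v sin (xi * v).
Proof.
by rewrite /=; apply: eq_Rintegral => v _; rewrite expR0 mul1r.
Qed.

End fourier_re_im.

Lemma measurable_cos (R : realType) : measurable_fun setT (@cos R).
Proof. by apply: continuous_measurable_fun; exact: continuous_cos. Qed.

Lemma measurable_sin (R : realType) : measurable_fun setT (@sin R).
Proof. by apply: continuous_measurable_fun; exact: continuous_sin. Qed.

Lemma bounded_measurable_cos d (T : measurableType d) (R : realType)
  (f : T -> R) : measurable_fun setT f -> bounded_measurable (fun x => cos (f x)).
Proof.
move=> mf; split; first exact: measurableT_comp (@measurable_cos R) mf.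
by exists 1 => x; rewrite ler_norml cos_geN1 cos_le1.
Qed.

Lemma bounded_measurable_sin d (T : measurableType d) (R : realType)
  (f : T -> R) : measurable_fun setT f -> bounded_measurable (fun x => sin (f x)).
Proof.
move=> mf; split; first exact: measurableT_comp (@measurable_sin R) mf.
by exists 1 => x; rewrite ler_norml sin_geN1 sin_le1.
Qed.

(** The half-line integral is the Cauchy kernel of width [e]; stopping at [N]
    leaves an error that is uniform in [y]. *)
Lemma damped_cosine_integral (R : realType) (e N y : R) : 0 < e -> 0 <= N ->
  `| \int[lebesgue_measure]_(xi in `[0, N]) (expR (- (e * `|xi|)) * cos (xi * y))
     - e / (e ^+ 2 + y ^+ 2) | <= expR (- (e * N)) * (2 / e).
Proof.
move=> e0 N0.
have d0 : 0 < e ^+ 2 + y ^+ 2 by rewrite ltr_wpDr ?sqr_ge0// exprn_gt0.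
pose G (xi : R) := (e ^+ 2 + y ^+ 2)^-1 *
  (expR (- (e * xi)) * (y * sin (xi * y) - e * cos (xi * y))).
rewrite (_ : \int[_]_(_ in _) _ = G N - G 0).
  rewrite /G !mulr0 !mul0r sin0 cos0 oppr0 expR0 mulr0 sub0r mulr1 mul1r mulrN.
  rewrite opprK [X in X - _]addrC mulrC -addrA [X in _ + X]addrC addrA subrr add0r.
  rewrite normrM (ger0_norm (ltW _)) ?invr_gt0// normrM (ger0_norm (expR_ge0 _)).
  rewrite mulrCA ler_wpM2l ?expR_ge0//.
  rewrite mulrC ler_pdivrMr//.
  apply: (@le_trans _ _ (`|y| + e)).
    rewrite (le_trans (ler_normB _ _))// !normrM (gtr0_norm e0) lerD//.
      by rewrite ler_piMr// ler_norml sin_geN1 sin_le1.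
    by rewrite ler_piMr ?(ltW e0)// ler_norml cos_geN1 cos_le1.
  rewrite mulrAC ler_pdivlMr// -(real_normK (num_real y)).
  by have := normr_ge0 y; nra.
have cf : continuous (fun xi : R => expR (- (e * xi)) * cos (xi * y)).
  by move=> x; apply/differentiable_continuous/derivable1_diffP; exact: ex_derive.
have dG x : is_derive x (1 : R) G (expR (- (e * x)) * cos (x * y)).
  rewrite /G; apply: is_derive_eq.
  rewrite /GRing.scale/=.
  by field; lra.
rewrite -(Rintegral_derivative N0 cf dG).
apply: eq_Rintegral => x; rewrite inE/= in_itv/= => /andP[x0 _].
by rewrite ger0_norm.
Qed.

Lemma cauchy_kernel_integral (R : realType) (e a c x : R) : 0 < e -> a <= c ->
  \int[lebesgue_measure]_(b in `[a, c]) (e / (e ^+ 2 + (x - b) ^+ 2)) =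
  atan ((c - x) / e) - atan ((a - x) / e).
Proof.
move=> e0 ac.
have d0 (b : R) : 0 < e ^+ 2 + (x - b) ^+ 2.
  by rewrite ltr_wpDr ?sqr_ge0// exprn_gt0.
have dG (b : R) : is_derive b (1 : R) (fun b => atan ((b - x) / e))
    (e / (e ^+ 2 + (x - b) ^+ 2)).
  apply: is_derive_eq; rewrite /GRing.scale/=.
  have := d0 b; set u := _ + _ => u0.
  have -> : 1 + ((b - x) / e) ^+ 2 = u / e ^+ 2 by rewrite /u; field; lra.
  by field; apply/andP; split; lra.
have cf : continuous (fun b : R => e / (e ^+ 2 + (x - b) ^+ 2)).
  move=> b; apply/differentiable_continuous/derivable1_diffP.
  apply: derivableM => //; apply: derivableV; first by rewrite gt_eqF.
  exact: ex_derive.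
exact: (Rintegral_derivative ac cf dG).
Qed.

Section fourier_uniqueness.
Context (R : realType) (mu nu : probability R R).
Hypothesis fourierE : fourier_stieltjes mu =1 fourier_stieltjes nu.

Let damped_cosine (e b : R) (z : R * R) : R :=
  expR (- (e * `|z.2|)) * cos (z.2 * (z.1 - b)).

Let bounded_damped_cosine e b : 0 < e -> bounded_measurable (damped_cosine e b).
Proof.
move=> e0; apply: bounded_measurableM; last first.
  apply: bounded_measurable_cos; apply: measurable_funM => //.
  by apply: measurable_funB.
split.
  apply: measurableT_comp; first exact: measurable_expR.
  apply: measurableT_comp => //; apply: measurable_funM => //.
  exact: measurableT_comp.
exists 1 => z; rewrite ger0_norm ?expR_ge0// -expR0 ler_expR.
by rewrite oppr_le0 mulr_ge0// ltW.
Qed.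

Let shifted_cosineE (m : probability R R) (xi b : R) :
  \int[m]_x cos (xi * (x - b)) =
  complex.Re (fourier_stieltjes m xi) * cos (xi * b) +
  complex.Im (fourier_stieltjes m xi) * sin (xi * b).
Proof.
rewrite Re_fourier_stieltjes Im_fourier_stieltjes.
have mx : measurable_fun setT (fun v : R => xi * v).
  exact: mulrl_measurable.
have ic := bounded_measurable_integrable m (bounded_measurable_cos mx).
have isn := bounded_measurable_integrable m (bounded_measurable_sin mx).
rewrite -!RintegralZr// -RintegralD//.
- by apply: eq_Rintegral => x _; rewrite mulrBr cosB.
- exact: (bounded_measurable_integrable m (bounded_measurableM
    (bounded_measurable_cos mx) (bounded_measurable_cst _))).
- exact: (bounded_measurable_integrable m (bounded_measurableM
    (bounded_measurable_sin mx) (bounded_measurable_cst _))).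
Qed.

Let bounded_cauchy (e b : R) : 0 < e ->
  bounded_measurable (fun x : R => e / (e ^+ 2 + (x - b) ^+ 2)).
Proof.
move=> e0.
have d0 (x : R) : 0 < e ^+ 2 + (x - b) ^+ 2.
  by rewrite ltr_wpDr ?sqr_ge0// exprn_gt0.
split.
  apply: continuous_measurable_fun => x.
  apply/differentiable_continuous/derivable1_diffP.
  apply: derivableM => //; apply: derivableV; first by rewrite gt_eqF.
  exact: ex_derive.
exists (e^-1) => x; rewrite ger0_norm ?divr_ge0 ?(ltW e0) ?(ltW (d0 _))//.
rewrite ler_pdivrMr// ler_pdivlMl// -expr2.
by rewrite lerDl sqr_ge0.
Qed.

(** After exchanging the integrals, the damped cosine sees a law only through
    its Fourier transform; and it is uniformly close to the Cauchy kernel. *)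
Let cauchy_smoothing (e b : R) : 0 < e ->
  \int[mu]_x (e / (e ^+ 2 + (x - b) ^+ 2)) =
  \int[nu]_x (e / (e ^+ 2 + (x - b) ^+ 2)).
Proof.
move=> e0; set k := fun x : R => _.
have dampedE N : \int[mu]_x \int[lebesgue_measure]_(xi in `[0, N]) damped_cosine e b (x, xi) =
                 \int[nu]_x \int[lebesgue_measure]_(xi in `[0, N]) damped_cosine e b (x, xi).
  rewrite !Rintegral_fubini_itv//; try exact: bounded_damped_cosine.
  apply: eq_Rintegral => xi _; rewrite /damped_cosine/=.
  have mx : measurable_fun setT (fun v : R => xi * (v - b)).
    by apply: measurable_funM => //; apply: measurable_funB.
  have ic (m : probability R R) := bounded_measurable_integrable m (bounded_measurable_cos mx).
  rewrite (RintegralZl _ measurableT (ic mu)) (RintegralZl _ measurableT (ic nu)).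
  by rewrite !shifted_cosineE fourierE.
pose J N x := \int[lebesgue_measure]_(xi in `[0, N]) damped_cosine e b (x, xi).
have approx (m : probability R R) (N : R) : 0 <= N ->
    `|\int[m]_x J N x - \int[m]_x k x| <= expR (- (e * N)) * (2 / e).
  move=> N0.
  have bJ : bounded_measurable (J N).
    exact: (bounded_measurable_Rintegral_itv m 0 N (bounded_damped_cosine b e0)).
  rewrite -RintegralB//; last 2 first.
  - exact: bounded_measurable_integrable.
  - exact: bounded_measurable_integrable (bounded_cauchy b e0).
  apply: le_Rintegral_bounded => [|x].
    by case: (bounded_measurableB bJ (bounded_cauchy b e0)).
  exact (damped_cosine_integral (x - b) e0 N0).
have close (N : R) : 0 <= N ->
    `|\int[mu]_x k x - \int[nu]_x k x| <= expR (- (e * N)) * (4 / e).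
  move=> N0; rewrite (_ : 4 / e = 2 / e + 2 / e); last by field; lra.
  rewrite mulrDr.
  rewrite (_ : _ - _ = (\int[nu]_x J N x - \int[nu]_x k x) -
      (\int[mu]_x J N x - \int[mu]_x k x)); last by rewrite /J dampedE; ring.
  by rewrite (le_trans (ler_normB _ _))// lerD// approx.
apply/eqP; rewrite -subr_eq0 -normr_le0; apply/ler_addgt0Pr => h h0.
rewrite add0r.
(* for this value of [N], already [1 + e * N <= expR (e * N)] gives the bound *)
have N0 : 0 <= 4 / (e ^+ 2 * h) by rewrite divr_ge0// mulr_ge0 ?sqr_ge0// ltW.
apply: (le_trans (close _ N0)); rewrite mulrA ler_pdivrMr//.
rewrite expRN ler_pdivrMl ?expR_gt0//.
have := expR_ge1Dx (e * (4 / (e ^+ 2 * h))).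
rewrite (_ : e * _ = 4 / (e * h)); last by field; lra.
move=> expD.
apply: (@le_trans _ _ ((1 + 4 / (e * h)) * (h * e))); last first.
  by rewrite ler_wpM2r// mulr_ge0 ?ltW.
rewrite mulrDl mul1r (_ : 4 / (e * h) * (h * e) = 4); last by field; lra.
by rewrite lerDr mulr_ge0 ?ltW.
Qed.

Lemma atan_smoothing (e a c : R) : 0 < e -> a <= c ->
  \int[mu]_x (atan ((c - x) / e) - atan ((a - x) / e)) =
  \int[nu]_x (atan ((c - x) / e) - atan ((a - x) / e)).
Proof.
move=> e0 ac.
have bk : bounded_measurable
    (fun z : R * R => e / (e ^+ 2 + (z.1 - z.2) ^+ 2)).
  have := bounded_cauchy 0 e0.
  move=> /(bounded_measurable_comp (h := fun z : R * R => z.1 - z.2)).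
  move=> /(_ (measurable_funB measurable_fst measurable_snd)).
  by under eq_fun do rewrite subr0.
transitivity (\int[mu]_x \int[lebesgue_measure]_(b in `[a, c])
    (e / (e ^+ 2 + (x - b) ^+ 2))).
  by apply: eq_Rintegral => x _; rewrite cauchy_kernel_integral.
transitivity (\int[nu]_x \int[lebesgue_measure]_(b in `[a, c])
    (e / (e ^+ 2 + (x - b) ^+ 2))); last first.
  by apply: eq_Rintegral => x _; rewrite cauchy_kernel_integral.
rewrite (Rintegral_fubini_itv mu a c bk) (Rintegral_fubini_itv nu a c bk).
by apply: eq_Rintegral => b _; exact: cauchy_smoothing.
Qed.

Lemma measurable_atan : measurable_fun setT (@atan R).
Proof. by apply: continuous_measurable_fun; exact: continuous_atan. Qed.

Let eps (n : nat) : R := n.+1%:R^-1 ^+ 2.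

Let eps_gt0 n : 0 < eps n. Proof. by rewrite exprn_gt0. Qed.

(** The shift [1/(n+1)] is much larger than the width [1/(n+1)^2], so the point
    [b] itself ends up on the left of the transition. *)
Let step n (b x : R) : R := atan ((b + n.+1%:R^-1 - x) / eps n).

Let measurable_step n b : measurable_fun setT (step n b).
Proof.
apply: measurableT_comp measurable_atan _; apply: measurable_funM => //.
exact: measurable_funB.
Qed.

Let step_le (n : nat) (b x : R) : `|step n b x| <= pi / 2.
Proof. by rewrite ler_norml !ltW// ?atan_gtNpi2// atan_ltpi2. Qed.

Let cvg_step b x :
  step n b x @[n --> \oo] --> (if x <= b then pi / 2 else - (pi / 2)).
Proof.
have epsE n z : z / eps n = z * n.+1%:R ^+ 2.
  by rewrite /eps exprVn invrK.
case: ifPn => [xb|].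
  have H : (b + n.+1%:R^-1 - x) / eps n @[n --> \oo] --> +oo.
    apply: (@ger_cvgy _ _ _ _ (fun n => n%:R : R)); last exact: cvgr_idn.
    near=> n; rewrite epsE expr2 mulrA.
    have n0 : 0 < n.+1%:R :> R by [].
    rewrite (@le_trans _ _ n.+1%:R)//; first by rewrite ler_nat.
    rewrite ler_peMl// ?(ltW n0)//.
    rewrite addrAC mulrDl mulVf ?gt_eqF// lerDr mulr_ge0// ?(ltW n0)//.
    by rewrite subr_ge0.
  exact: (cvg_comp _ _ H (@cvgy_atan R)).
rewrite -ltNge => bx.
have H : - ((b + n.+1%:R^-1 - x) / eps n) @[n --> \oo] --> +oo.
  apply: (@ger_cvgy _ _ _ _ (fun n => n%:R : R)); last exact: cvgr_idn.
  near=> n; rewrite epsE expr2 mulrA -mulNr.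
  have n0 : 0 < n.+1%:R :> R by [].
  have xb : 0 < x - b by rewrite subr_gt0.
  rewrite (@le_trans _ _ n.+1%:R)//; first by rewrite ler_nat.
  rewrite ler_peMl// ?(ltW n0)//.
  rewrite -mulNr opprB opprD addrA mulrDl mulNr mulVf ?gt_eqF//.
  rewrite lerBrDr -ler_pdivrMl//.
  rewrite (@le_trans _ _ n%:R)//; last by rewrite ler_nat.
  by near: n; exact: nbhs_infty_ger.
rewrite (_ : (fun n => step n b x) = (fun n => - atan (- ((b + n.+1%:R^-1 - x) / eps n)))).
  exact: cvgN (cvg_comp _ _ H (@cvgy_atan R)).
by apply/funext => n; rewrite atanN opprK.
Unshelve. all: by end_near.
Qed.

Let Rintegral_step (m : probability R R) a c : a <= c ->
  \int[m]_x (step n c x - step n a x) @[n --> \oo] --> pi * fine (m `]a, c]%classic).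
Proof.
move=> ac.
pose f n x := (step n c x - step n a x)%:E.
pose g (x : R) := ((pi : R) * \1_(`]a, c]%classic) x)%:E.
have mf n : measurable_fun setT (f n).
  by apply/measurable_EFinP; apply: measurable_funB.
have mg : measurable_fun setT g.
  by apply/measurable_EFinP; apply: measurable_funM => //; exact: measurable_indic.
have fg : {ae m, forall x, setT x -> f ^~ x @ \oo --> g x}.
  apply: aeW => x _; apply: cvg_EFin; first by near=> n.
  rewrite /f/= (_ : pi * _ = (if x <= c then pi / 2 else - (pi / 2)) -
                  (if x <= a then pi / 2 else - (pi / 2))); last first.
    rewrite indicE; case: (leP x a) => xa.
      rewrite (le_trans xa ac) subrr memNset ?mulr0//=.
      by rewrite in_itv/= ltNge xa.
    case: (leP x c) => xc.
      by rewrite mem_set ?mulr1//= ?in_itv/= ?xa// opprK -splitr.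
    by rewrite subrr memNset ?mulr0//= in_itv/= xa/= leNgt xc.
  by apply: cvgB; exact: cvg_step.
have ip : m.-integrable setT (cst (pi : R)%:E : R -> \bar R).
  exact: (bounded_measurable_integrable m (bounded_measurable_cst pi)).
have fp : {ae m, forall x n, setT x -> (`|f n x| <= (pi : R)%:E)%E}.
  apply: aeW => x n _; rewrite lee_fin [X in _ <= X]splitr.
  by rewrite (le_trans (ler_normB _ _))// lerD.
have [_ _ H] := dominated_convergence measurableT mf mg fg ip fp.
have -> : pi * fine (m `]a, c]%classic) = fine (\int[m]_x g x)%E.
  transitivity (\int[m]_x ((pi : R) * \1_(`]a, c]%classic) x)); last by [].
  rewrite RintegralZl//; last first.
    exact: integrable_indic.
  by rewrite /Rintegral integral_indic// setIT.
apply: fine_cvg; rewrite fineK//.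
apply: (@integrable_fin_num _ _ _ m) => //.
by have [] := dominated_convergence measurableT mf mg fg ip fp.
Unshelve. all: by end_near.
Qed.

(** Two laws with the same Fourier transform agree. Integrating the transform
    against an exponentially damped cosine gives the convolution of the law
    with a Cauchy kernel, whose integral over an interval is a difference of
    arctangents; this difference tends to pi times the indicator of the
    half-open interval when the width of the kernel vanishes faster than the
    shift of its centre. *)
Lemma fourier_stieltjes_inj A : measurable A -> mu A = nu A.
Proof.
have itvE a c : mu `]a, c]%classic = nu `]a, c]%classic.
  have [ac|ca] := leP a c; last first.
    by rewrite set_itv_ge ?measure0// bnd_simp -leNgt ltW.
  rewrite -[LHS]fineK ?fin_num_measure// -[RHS]fineK ?fin_num_measure//.
  congr EFin; have pi0 : pi != 0 :> R by rewrite gt_eqF// pi_gt0.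
  apply: (mulfI pi0).
  have H1 := @Rintegral_step mu a c ac; have H2 := @Rintegral_step nu a c ac.
  suff stepE : (fun n => \int[mu]_x (step n c x - step n a x)) =
      (fun n => \int[nu]_x (step n c x - step n a x)).
    by rewrite stepE in H1; exact: (cvg_unique _ H1 H2).
  by apply/funext => n; rewrite /step atan_smoothing// lerD2r.
move=> mA.
apply: (measure_unique (@ocitv R) (fun k => `](- k%:R), k%:R]%classic)) => //.
- exact: ocitvI.
- by move=> k; exact: is_ocitv.
- exact: bigcup_itvT.
- by move=> _ [[a b] _ <-]; exact: itvE.
- by move=> k; rewrite ltey_eq fin_num_measure.
Qed.

End fourier_uniqueness.

(** * Countable mixtures *)

Lemma mnormalize_mass1 d (T : measurableType d) (R : realType)
    (m : {measure set T -> \bar R}) (P : probability T R) :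
  m setT = 1%E -> mnormalize m P = m :> (set T -> \bar R).
Proof.
move=> m1; apply/funext => A; rewrite /mnormalize m1 onee_eq0/=.
by rewrite invr1 mule1.
Qed.

Lemma cvg_nneseries_EFin (R : realType) (u : nat -> R) (s : R) :
  (forall n, 0 <= u n) -> (\sum_(0 <= n <oo) (u n)%:E = s%:E)%E ->
  \sum_(0 <= k < n) u k @[n --> \oo] --> s.
Proof.
move=> u0 us.
have : (\sum_(0 <= k < n) (u k)%:E)%E @[n --> \oo] --> s%:E.
  by rewrite -us; apply: is_cvg_nneseries => n _ _; rewrite lee_fin.
move/fine_cvg; apply: cvg_trans; apply: near_eq_cvg; near=> n.
by rewrite /= sumEFin.
Unshelve. all: by end_near.
Qed.

Section mixture.
Context d (T : measurableType d) (R : realType).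
Variables (w : nat -> {nonneg R}) (m : nat -> probability T R).

Let wm n : {measure set T -> \bar R} := mscale (w n) (m n).

(** The renormalization makes the mixture a probability whatever the weights;
    it is the identity when they sum to one. *)
Definition mixture : probability T R := mnormalize (mseries wm 0) (m 0%N).

Hypothesis w1 : (\sum_(0 <= n <oo) ((w n)%:num)%:E = 1)%E.

Lemma mixture_mseries : (mixture : set T -> \bar R) = mseries wm 0.
Proof.
have mT : mseries wm 0 [set: T] = 1%E.
  rewrite /mseries -[RHS]w1; apply: eq_eseriesr => n _.
  by rewrite -[RHS]mule1; congr (_ * _)%E; exact: probability_setT.
exact: mnormalize_mass1.
Qed.

Lemma ge0_integral_mixture (f : T -> \bar R) :
  measurable_fun setT f -> (forall x, 0 <= f x)%E ->
  (\int[mixture]_x f x =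
   \sum_(0 <= n <oo) ((w n)%:num)%:E * \int[m n]_x f x)%E.
Proof.
move=> mf f0; rewrite mixture_mseries ge0_integral_measure_series//.
by apply: eq_eseriesr => n _; rewrite ge0_integral_mscale.
Qed.

Lemma cvg_Rintegral_mixture (f : T -> R) : bounded_measurable f ->
  \sum_(0 <= k < n) ((w k)%:num * \int[m k]_x f x) @[n --> \oo] -->
    \int[mixture]_x f x.
Proof.
(* adding a bound of [f] to it reduces to nonnegative integrands *)
move=> bf; have [mf [C fC]] := bf.
have C0 : 0 <= C by exact: le_trans (fC point).
have shift (P : probability T R) :
    (\int[P]_x (f x + C)%:E = (\int[P]_x f x + C)%:E)%E.
  have bfC := bounded_measurableD bf (bounded_measurable_cst C).
  rewrite -[LHS]fineK; last first.
    exact: integrable_fin_num (bounded_measurable_integrable P bfC).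
  rewrite -[fine _]/(\int[P]_x (f x + C)) RintegralD//; last 2 first.
  - exact: bounded_measurable_integrable.
  - exact: bounded_measurable_integrable (bounded_measurable_cst C).
  rewrite Rintegral_cst// [X in fine X](_ : _ = 1%E) ?mulr1//.
  exact: probability_setT.
have fC0 x : (0 <= (f x + C)%:E)%E.
  by rewrite lee_fin -lerBlDr sub0r; have := fC x; rewrite ler_norml => /andP[].
have mfC : measurable_fun setT (fun x => (f x + C)%:E).
  by apply/measurable_EFinP; exact: measurable_funD.
have := ge0_integral_mixture mfC fC0.
rewrite shift; under eq_eseriesr do rewrite shift.
move=> sumE.
have w0 k : (0 <= ((w k)%:num)%:E :> \bar R)%E by rewrite lee_fin.
have cvgw : \sum_(0 <= k < n) (w k)%:num @[n --> \oo] --> (1 : R).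
  exact: cvg_nneseries_EFin.
have w0' k : 0 <= (w k)%:num * (\int[m k]_x f x + C).
  rewrite mulr_ge0// -lee_fin -shift.
  by apply: integral_ge0.
have := cvg_nneseries_EFin w0' (esym sumE).
move=> /cvgB /(_ (cvgM cvgw (cvg_cst C))).
rewrite mul1r addrK; apply: cvg_trans; apply: near_eq_cvg; near=> n.
rewrite !fctE /= mulr_suml -sumrB; apply: eq_bigr => k _.
by rewrite mulrDr addrK.
Unshelve. all: by end_near.
Qed.

End mixture.

(** * Complex-valued integrals *)

Import ComplexField.Normc.

Section normc_theory.
Context (R : realType).
Implicit Types (z t : R[i]).

Lemma complexP z t : complex.Re z = complex.Re t ->
  complex.Im z = complex.Im t -> z = t.
Proof. by case: z t => [a b] [c d] /= -> ->. Qed.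

Lemma ReM z t : complex.Re (z * t) =
  complex.Re z * complex.Re t - complex.Im z * complex.Im t.
Proof. by case: z t => [a b] [c d]. Qed.

Lemma ImM z t : complex.Im (z * t) =
  complex.Re z * complex.Im t + complex.Im z * complex.Re t.
Proof. by case: z t => [a b] [c d]. Qed.

Lemma ReD z t : complex.Re (z + t) = complex.Re z + complex.Re t.
Proof. by case: z t => [a b] [c d]. Qed.

Lemma ImD z t : complex.Im (z + t) = complex.Im z + complex.Im t.
Proof. by case: z t => [a b] [c d]. Qed.

Lemma ReN z : complex.Re (- z) = - complex.Re z.
Proof. by case: z => [a b]. Qed.

Lemma ImN z : complex.Im (- z) = - complex.Im z.
Proof. by case: z => [a b]. Qed.

Lemma Re_sum n (F : 'I_n -> R[i]) :
  complex.Re (\sum_(j < n) F j) = \sum_(j < n) complex.Re (F j).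
Proof. by rewrite (big_morph _ ReD (erefl : complex.Re 0 = 0)). Qed.

Lemma Im_sum n (F : 'I_n -> R[i]) :
  complex.Im (\sum_(j < n) F j) = \sum_(j < n) complex.Im (F j).
Proof. by rewrite (big_morph _ ImD (erefl : complex.Im 0 = 0)). Qed.

Lemma normcE2 z : normc z = Num.sqrt (complex.Re z ^+ 2 + complex.Im z ^+ 2).
Proof. by case: z. Qed.

Lemma normc_ge0 z : 0 <= normc z.
Proof. by rewrite normcE2 sqrtr_ge0. Qed.

Lemma sqr_normcE z : normc z ^+ 2 = complex.Re z ^+ 2 + complex.Im z ^+ 2.
Proof. by rewrite normcE2 sqr_sqrtr// addr_ge0 ?sqr_ge0. Qed.

Lemma normc_cauchy_schwarz z t :
  complex.Re z * complex.Re t + complex.Im z * complex.Im t <= normc z * normc t.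
Proof.
case: (lerP (complex.Re z * complex.Re t + complex.Im z * complex.Im t) 0) => [h|h].
  by rewrite (le_trans h)// mulr_ge0 ?normc_ge0.
rewrite -(@ler_pXn2r _ 2)// ?nnegrE ?mulr_ge0 ?normc_ge0 ?(ltW h)//.
rewrite exprMn !sqr_normcE.
have := sqr_ge0 (complex.Re z * complex.Im t - complex.Im z * complex.Re t).
by nra.
Qed.

Lemma normr_Re_le z : `|complex.Re z| <= normc z.
Proof.
rewrite normcE2 -sqrtr_sqr ler_wsqrtr// lerDl sqr_ge0 //.
Qed.

Lemma normr_Im_le z : `|complex.Im z| <= normc z.
Proof.
rewrite normcE2 -sqrtr_sqr ler_wsqrtr// lerDr sqr_ge0 //.
Qed.

End normc_theory.

Definition Cbounded_measurable d (T : measurableType d) (R : realType)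
    (f : T -> R[i]) : Prop :=
  bounded_measurable (fun x => complex.Re (f x)) /\
  bounded_measurable (fun x => complex.Im (f x)).

Section Cbounded_measurable_theory.
Context d (T : measurableType d) (R : realType).
Implicit Types (f g : T -> R[i]).

Lemma Cbounded_measurable_cst (c : R[i]) : Cbounded_measurable (fun _ : T => c).
Proof. by split; exact: bounded_measurable_cst. Qed.

Lemma Cbounded_measurableM f g : Cbounded_measurable f ->
  Cbounded_measurable g -> Cbounded_measurable (fun x => f x * g x).
Proof.
move=> [rf jf] [rg jg]; split.
  under eq_fun do rewrite ReM.
  by apply: bounded_measurableB; exact: bounded_measurableM.
under eq_fun do rewrite ImM.
by apply: bounded_measurableD; exact: bounded_measurableM.
Qed.

Lemma Cbounded_measurableD f g : Cbounded_measurable f ->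
  Cbounded_measurable g -> Cbounded_measurable (fun x => f x + g x).
Proof.
move=> [rf jf] [rg jg]; split.
  by under eq_fun do rewrite ReD; exact: bounded_measurableD.
by under eq_fun do rewrite ImD; exact: bounded_measurableD.
Qed.

Lemma Cbounded_measurableN f : Cbounded_measurable f ->
  Cbounded_measurable (fun x => - f x).
Proof.
move=> [rf jf]; split.
  by under eq_fun do rewrite ReN; exact: bounded_measurableN.
by under eq_fun do rewrite ImN; exact: bounded_measurableN.
Qed.

Lemma Cbounded_measurableB f g : Cbounded_measurable f ->
  Cbounded_measurable g -> Cbounded_measurable (fun x => f x - g x).
Proof.
by move=> bf bg; apply: Cbounded_measurableD => //; exact: Cbounded_measurableN.
Qed.

Lemma Cbounded_measurable_sum n (F : nat -> T -> R[i]) :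
  (forall k, Cbounded_measurable (F k)) ->
  Cbounded_measurable (fun x => \sum_(k < n) F k x).
Proof.
move=> bF; elim: n => [|n IH].
  by under eq_fun do rewrite big_ord0; exact: Cbounded_measurable_cst.
by under eq_fun do rewrite big_ord_recr/=; exact: Cbounded_measurableD.
Qed.

Lemma Cbounded_measurable_comp d' (T' : measurableType d') (h : T' -> T) f :
  measurable_fun setT h -> Cbounded_measurable f ->
  Cbounded_measurable (fun x => f (h x)).
Proof.
by move=> mh [rf jf]; split; [exact: (bounded_measurable_comp mh rf)|
  exact: (bounded_measurable_comp mh jf)].
Qed.

Variable P : {finite_measure set T -> \bar R}.
Local Notation E f := (Cintegral P setT f).

Lemma CintegralD f g : Cbounded_measurable f -> Cbounded_measurable g ->
  E (fun x => f x + g x) = E f + E g.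
Proof.
move=> [rf jf] [rg jg]; apply: complexP => /=.
  under eq_Rintegral do rewrite ReD.
  by rewrite RintegralD//; exact: bounded_measurable_integrable.
under eq_Rintegral do rewrite ImD.
by rewrite RintegralD//; exact: bounded_measurable_integrable.
Qed.

Lemma CintegralZl (c : R[i]) f : Cbounded_measurable f ->
  E (fun x => c * f x) = c * E f.
Proof.
move=> [rf jf].
have ib (h : T -> R) (bh : bounded_measurable h) (k : R) :
    P.-integrable setT (EFin \o (fun x => k * h x)).
  exact: (bounded_measurable_integrable P
    (bounded_measurableM (bounded_measurable_cst k) bh)).
have Zl (h : T -> R) (bh : bounded_measurable h) (k : R) :
    \int[P]_x (k * h x) = k * \int[P]_x h x.
  by rewrite RintegralZl//; exact: bounded_measurable_integrable.
apply: complexP; rewrite ?ReM ?ImM /=.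
  under eq_Rintegral do rewrite ReM.
  rewrite RintegralB//; [|exact: ib|exact: ib].
  by rewrite !Zl.
under eq_Rintegral do rewrite ImM.
rewrite RintegralD//; [|exact: ib|exact: ib].
by rewrite !Zl.
Qed.

Lemma CintegralB f g : Cbounded_measurable f -> Cbounded_measurable g ->
  E (fun x => f x - g x) = E f - E g.
Proof.
move=> bf bg; rewrite -[- E g]mulN1r -CintegralZl// -CintegralD//.
  by congr (E _); apply/funext => x; rewrite mulN1r.
by apply: Cbounded_measurableM => //; exact: Cbounded_measurable_cst.
Qed.

Lemma Cintegral_sum n (F : nat -> T -> R[i]) :
  (forall k, Cbounded_measurable (F k)) ->
  E (fun x => \sum_(k < n) F k x) = \sum_(k < n) E (F k).
Proof.
move=> bF; elim: n => [|n IH].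
  rewrite big_ord0; apply: complexP => /=.
    under eq_Rintegral do rewrite big_ord0.
    by rewrite /= Rintegral_cst// mul0r.
  under eq_Rintegral do rewrite big_ord0.
  by rewrite /= Rintegral_cst// mul0r.
rewrite big_ord_recr/= -IH -CintegralD//.
  by congr (E _); apply/funext => x; rewrite big_ord_recr.
exact: Cbounded_measurable_sum.
Qed.

End Cbounded_measurable_theory.

(** Pairing the integral [z] with itself turns its square modulus into a real
    integral, whose integrand is at most [normc z * c]. *)
Lemma normc_Cintegral_le d (T : measurableType d) (R : realType)
    (P : probability T R) (f : T -> R[i]) (c : R) :
  Cbounded_measurable f -> (forall x, normc (f x) <= c) ->
  normc (Cintegral P setT f) <= c.
Proof.
move=> [rf jf] fc.
set z := Cintegral P setT f.
have [z0|z0] := lerP (normc z) 0.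
  by rewrite (le_trans z0)// (le_trans (normc_ge0 (f point))).
rewrite -(ler_pM2l z0) -expr2 sqr_normcE.
have bz : bounded_measurable (fun x => complex.Re z * complex.Re (f x) +
    complex.Im z * complex.Im (f x)).
  by apply: bounded_measurableD; apply: bounded_measurableM => //;
    exact: bounded_measurable_cst.
have -> : complex.Re z ^+ 2 + complex.Im z ^+ 2 =
    \int[P]_x (complex.Re z * complex.Re (f x) + complex.Im z * complex.Im (f x)).
  have ib (h : T -> R) (bh : bounded_measurable h) (k : R) :
      P.-integrable setT (EFin \o (fun x => k * h x)).
    exact: (bounded_measurable_integrable P
      (bounded_measurableM (bounded_measurable_cst k) bh)).
  rewrite RintegralD//; [|exact: ib|exact: ib].
  by rewrite !RintegralZl//; exact: bounded_measurable_integrable.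
apply: (@le_trans _ _ (\int[P]_(x in setT) (normc z * c))).
  apply: le_Rintegral => //.
  - exact: bounded_measurable_integrable.
  - exact: bounded_measurable_integrable (bounded_measurable_cst _).
  - move=> x _; rewrite (le_trans (normc_cauchy_schwarz _ _))//.
    by rewrite ler_wpM2l// ltW.
rewrite Rintegral_cst// [X in fine X](_ : _ = 1%E) ?mulr1//.
exact: probability_setT.
Qed.

Lemma Cintegral_image d d' (T : measurableType d) (T' : measurableType d')
    (R : realType) (P : probability T R) (h : T -> T')
    (mh : measurable_fun setT h) (f : T' -> R[i]) :
  Cbounded_measurable f ->
  Cintegral (image_probability P mh) setT f = Cintegral P setT (fun x => f (h x)).
Proof.
by move=> [rf jf]; apply: complexP; rewrite /= (Rintegral_image P mh).
Qed.

Section Cfubini.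
Context d1 d2 (T1 : measurableType d1) (T2 : measurableType d2) (R : realType).
Variables (m1 : {finite_measure set T1 -> \bar R}).
Variables (m2 : {finite_measure set T2 -> \bar R}).

Lemma Cintegral_prod (f : T1 * T2 -> R[i]) : Cbounded_measurable f ->
  Cintegral (m1 \x m2)%E setT f =
  Cintegral m1 setT (fun x => Cintegral m2 setT (fun y => f (x, y))).
Proof.
by move=> [rf jf]; apply: complexP; rewrite /= Rintegral_prod.
Qed.

Lemma Cbounded_measurable_Cintegral (f : T1 * T2 -> R[i]) :
  Cbounded_measurable f ->
  Cbounded_measurable (fun x => Cintegral m2 setT (fun y => f (x, y))).
Proof.
move=> [rf jf]; split.
  exact: bounded_measurable_Rintegral1 rf.
exact: bounded_measurable_Rintegral1 jf.
Qed.

Lemma Cintegral_prod_mul (f : T1 -> R[i]) (g : T2 -> R[i]) :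
  Cbounded_measurable f -> Cbounded_measurable g ->
  Cintegral (m1 \x m2)%E setT (fun z => f z.1 * g z.2) =
  Cintegral m1 setT f * Cintegral m2 setT g.
Proof.
move=> bf bg; rewrite Cintegral_prod; last first.
  by apply: Cbounded_measurableM;
    [exact: (Cbounded_measurable_comp _ bf)|exact: (Cbounded_measurable_comp _ bg)].
transitivity (Cintegral m1 setT (fun x => Cintegral m2 setT g * f x)).
  congr Cintegral; apply/funext => x.
  by rewrite -[LHS]/(Cintegral m2 setT (fun y => f x * g y)) CintegralZl// mulrC.
by rewrite CintegralZl// mulrC.
Qed.

End Cfubini.

Lemma CexpD (R : realType) (z t : R[i]) : Cexp (z + t) = Cexp z * Cexp t.
Proof.
by case: z t => [a b] [c d]; apply: complexP;
  rewrite /= expRD ?cosD ?sinD; ring.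
Qed.

Lemma normc_Cexp (R : realType) (z : R[i]) : normc (Cexp z) = expR (complex.Re z).
Proof.
rewrite normcE2/= !exprMn -mulrDr cos2Dsin2 mulr1 sqrtr_sqr.
by rewrite ger0_norm ?expR_ge0.
Qed.

Lemma Cbounded_measurable_Cexp d (T : measurableType d) (R : realType)
    (f g : T -> R) : measurable_fun setT f -> measurable_fun setT g ->
  (forall x, f x <= 0) ->
  Cbounded_measurable (fun x => Cexp (Complex (f x) (g x))).
Proof.
move=> mf mg f0.
have be : bounded_measurable (fun x => expR (f x)).
  split; first exact: measurableT_comp (@measurable_expR R) mf.
  by exists 1 => x; rewrite ger0_norm ?expR_ge0// -expR0 ler_expR.
by split; apply: bounded_measurableM => //=;
  [exact: bounded_measurable_cos|exact: bounded_measurable_sin].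
Qed.

Lemma Cbounded_measurable_cis d (T : measurableType d) (R : realType)
    (g : T -> R) : measurable_fun setT g ->
  Cbounded_measurable (fun x => Cexp (Complex 0 (g x))).
Proof. by move=> mg; apply: Cbounded_measurable_Cexp. Qed.

Section fourier_theory.
Context (R : realType) (mu : probability R R).

Lemma normc_fourier_le1 xi : normc (fourier_stieltjes mu xi) <= 1.
Proof.
apply: normc_Cintegral_le.
  by apply: Cbounded_measurable_cis; exact: mulrl_measurable.
by move=> v; rewrite normc_Cexp expR0.
Qed.

Lemma Cbounded_measurable_fourier : Cbounded_measurable (fourier_stieltjes mu).
Proof.
apply: (Cbounded_measurable_Cintegral mu mu
  (f := fun z : R * R => Cexp (Complex 0 (z.1 * z.2)))).
by apply: Cbounded_measurable_cis; exact: measurable_funM.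
Qed.

End fourier_theory.

(** * Random linear combinations of independent samples *)

Definition independent_pair d1 d2 (T1 : measurableType d1)
    (T2 : measurableType d2) (R : realType) (k1 : probability T1 R)
    (k2 : probability T2 R) : probability (T1 * T2)%type R := (k1 \x k2)%E.

Section collision.
Context d (T : measurableType d) (R : realType) (P : probability T R).
Context d' (V : measurableType d') (op : T * (V * V) -> V).
Hypothesis mop : measurable_fun setT op.

(** The state space and the combination [op] are left arbitrary: the line is
    needed for the mixing measure, the plane for couplings. *)
Definition collision (k k' : probability V R) : probability V R :=
  image_probability (independent_pair P (independent_pair k k')) mop.

Variables k k' : probability V R.

Lemma ge0_integral_collision (f : V -> \bar R) :
  measurable_fun setT f -> (forall x, 0 <= f x)%E ->
  (\int[collision k k']_x f x =
   \int[P]_w \int[independent_pair k k']_z f (op (w, z)))%E.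
Proof.
move=> mf f0; rewrite /collision ge0_integral_image//.
exact: (@fubini_tonelli1 _ _ _ _ _ P (independent_pair k k') (f \o op)
  (measurableT_comp mf mop) (fun=> f0 _)).
Qed.

Lemma Cintegral_collision (f : V -> R[i]) : Cbounded_measurable f ->
  Cintegral (collision k k') setT f =
  Cintegral P setT (fun w => Cintegral (independent_pair k k') setT (fun z => f (op (w, z)))).
Proof.
move=> bf; rewrite /collision Cintegral_image// Cintegral_prod//.
exact: (Cbounded_measurable_comp mop bf).
Qed.

(** Given the weights, the exponential of a sum of independent terms factors.
    The observable [q], which will be a coordinate of the plane, only has to
    turn [op] into a linear combination. *)
Lemma fourier_collision (L M : T -> R) (q : V -> R) (mq : measurable_fun setT q) :
  (forall w x y, q (op (w, (x, y))) = L w * q x + M w * q y) ->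
  forall xi, fourier_stieltjes (image_probability (collision k k') mq) xi =
    Cexpectation P (fun w =>
      fourier_stieltjes (image_probability k mq) (L w * xi) *
      fourier_stieltjes (image_probability k' mq) (M w * xi)).
Proof.
move=> qop xi.
have bc (a : R) : Cbounded_measurable (fun v : R => Cexp (Complex 0 (a * v))).
  by apply: Cbounded_measurable_cis; exact: mulrl_measurable.
rewrite /fourier_stieltjes /Cexpectation.
rewrite Cintegral_image// Cintegral_collision; last first.
  exact: (Cbounded_measurable_comp mq (bc xi)).
congr Cintegral; apply/funext => w.
rewrite !Cintegral_image// -(@Cintegral_prod_mul _ _ _ _ _ k k');
  [|exact: (Cbounded_measurable_comp mq (bc _))|exact: (Cbounded_measurable_comp mq (bc _))].
congr Cintegral; apply/funext => -[x y].
rewrite -CexpD qop; congr Cexp; apply: complexP; rewrite ?ReD ?ImD/=; ring.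
Qed.

End collision.

(** * An additive majorant of the p-th absolute moment *)

(** This is Young's inequality for the product of [(1 + y) `^ a] and [1], with
    exponents [1/a] and [1/(1 - a)]. *)
Lemma powR_le_tangent (R : realType) (a y : R) : 0 < a -> a <= 1 ->
  -1 <= y -> (1 + y) `^ a <= 1 + a * y.
Proof.
move=> a0 a1 y1; have y0 : 0 <= 1 + y by lra.
have [->|aN1] := eqVneq a 1; first by rewrite powRr1// mul1r.
have a1' : 0 < 1 - a by rewrite subr_gt0 lt_neqAle aN1.
have inva : 0 < a^-1 by rewrite invr_gt0.
have inva1 : 0 < (1 - a)^-1 by rewrite invr_gt0.
have conj : a^-1^-1 + (1 - a)^-1^-1 = 1 by rewrite !invrK; ring.
have := conjugate_powR (powR_ge0 (1 + y) a) ler01 inva inva1 conj.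
rewrite mulr1 powR1 !invrK -powRrM divff ?gt_eqF// powRr1//.
move=> /le_trans; apply; rewrite le_eqVlt; apply/orP; left; apply/eqP; ring.
Qed.

(** The constant 4 is not optimal; what matters is that the linear term
    integrates to zero against a centred law. *)
Lemma powRD_le_add (R : realType) (p y : R) : 1 < p -> p <= 2 ->
  `|1 + y| `^ p <= 1 + p * y + 4 * `|y| `^ p.
Proof.
move=> p1 p2.
have p0 : 0 < p by lra.
have [y1|y1] := lerP y (-1).
  have yN : `|y| = - y by rewrite ler0_norm//; lra.
  have zN : `|1 + y| = - y - 1 by rewrite ler0_norm; lra.
  rewrite yN zN.
  have H1 : (- y - 1) `^ p <= (- y) `^ p.
    by apply: ge0_ler_powR; rewrite ?nnegrE; lra.
  have H2 : - y <= (- y) `^ p.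
    have Ny1 : 1 <= - y by lra.
    exact: le1r_powR Ny1 (ltW p1).
  nra.
have zp : `|1 + y| = 1 + y by rewrite ger0_norm; lra.
rewrite zp -mulr_powRB1//; last lra.
have [y2|y2] := lerP 1 y.
  have yp : `|y| = y by rewrite ger0_norm; lra.
  rewrite yp mulr_powRB1//; [|lra].
  apply: (@le_trans _ _ ((2 * y) `^ p)).
    by apply: ge0_ler_powR; rewrite ?nnegrE; lra.
  rewrite powRM; [|lra|lra].
  have : 2 `^ p <= 4 :> R.
    apply: (@le_trans _ _ (2 `^ 2)); first by apply: ler_powR; lra.
    by rewrite powR_mulrn; [nra|lra].
  have := powR_ge0 y p; nra.
have young : (1 + y) `^ (p - 1) <= 1 + (p - 1) * y.
  by apply: powR_le_tangent; lra.
have : y ^+ 2 <= `|y| `^ p.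
  rewrite -(real_normK (num_real y)) -(@powR_mulrn _ `|y|)//.
  have [->|y0] := eqVneq y 0.
    by rewrite normr0 !powR0//; lra.
  apply: ger_powR; last by [].
  by rewrite normr_gt0 y0 ler_norml; lra.
have := powR_ge0 `|y| p.
nra.
Qed.

Section moment_excess.
Context (R : realType) (p : R).

(** The supremum over [x] of the excess of the moment of [x + q] over
    [`|x| `^ p], as an upper bound. Unlike the moment, which it dominates by
    the case [x = 0], it adds up over independent centred summands without
    any multiplicative constant, so it can be iterated. *)
Definition moment_excess d (V : measurableType d) (q : V -> R)
    (k : probability V R) (A : R) : Prop :=
  forall x : R, (\int[k]_z (`|x + q z| `^ p)%:E <= (`|x| `^ p + A)%:E)%E.

Lemma measurable_power_norm d (V : measurableType d) (f : V -> R) :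
  measurable_fun setT f -> measurable_fun setT (fun z => (`|f z| `^ p)%:E).
Proof.
move=> mf; apply/measurable_EFinP.
apply: (measurableT_comp (measurable_powR p)).
exact: measurableT_comp.
Qed.

Lemma moment_excess_scale d (V : measurableType d) (q : V -> R)
    (k : probability V R) (A c x : R) : 1 < p -> measurable_fun setT q ->
  moment_excess q k A -> 0 <= c ->
  (\int[k]_z (`|x + c * q z| `^ p)%:E <= (`|x| `^ p + c `^ p * A)%:E)%E.
Proof.
move=> p1 mq kA; rewrite le_eqVlt => /predU1P[<-|c0].
  under eq_integral do rewrite mul0r addr0.
  rewrite integral_cst// powR0 ?gt_eqF//; last by lra.
  rewrite mul0r addr0 [X in (_ * X)%E](_ : _ = 1%E) ?mule1//.
  exact: probability_setT.
have scaleE y : `|x + c * y| `^ p = c `^ p * `|c^-1 * x + y| `^ p.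
  rewrite -powRM ?(ltW c0)// -[X in X * `|_|](gtr0_norm c0) -normrM mulrDr.
  by rewrite mulrA divff ?gt_eqF// mul1r.
under eq_integral do rewrite scaleE EFinM.
rewrite ge0_integralZl//; last 2 first.
- by apply: measurable_power_norm; exact: measurable_funD.
- by rewrite lee_fin powR_ge0.
apply: (@le_trans _ _ ((c `^ p)%:E * (`|c^-1 * x| `^ p + A)%:E)%E).
  by rewrite lee_wpmul2l ?lee_fin ?powR_ge0//; exact: kA.
rewrite -EFinM lee_fin mulrDr -powRM ?(ltW c0)//.
by rewrite -[X in X * `|_|](gtr0_norm c0) -normrM mulrA divff ?gt_eqF// mul1r.
Qed.

(** Integrating the rescaled inequality [powRD_le_add], its linear term
    vanishes and its constant term is [`|x| `^ p]. *)
Lemma moment_excess_centered d (V : measurableType d) (q : V -> R)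
    (k : probability V R) : 1 < p -> p <= 2 -> measurable_fun setT q ->
  (\int[k]_z (`|q z| `^ p)%:E < +oo)%E -> \int[k]_z q z = 0 ->
  moment_excess q k (4 * \int[k]_z (`|q z| `^ p)).
Proof.
move=> p1 p2 mq qp q0 x.
have mqp : measurable_fun setT (fun z => (`|q z| `^ p)%:E).
  exact: measurable_power_norm.
have ip : k.-integrable setT (EFin \o (fun z => `|q z| `^ p)).
  apply/integrableP; split => //.
  by under eq_integral do rewrite /= ger0_norm ?powR_ge0//.
have i1 (c : R) : k.-integrable setT (EFin \o (fun=> c)).
  exact: bounded_measurable_integrable (bounded_measurable_cst c).
have iq : k.-integrable setT (EFin \o q).
  apply: (@le_integrable _ _ _ k setT measurableT _ (EFin \o (fun z => 1 + `|q z| `^ p))).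
  - exact/measurable_EFinP.
  - move=> z _; rewrite lee_fin [leRHS]ger0_norm ?addr_ge0 ?powR_ge0//.
    have [h|h] := lerP `|q z| 1; first by rewrite (le_trans h)// lerDl powR_ge0.
    by rewrite (le_trans (le1r_powR (ltW h) (ltW p1)))// lerDr.
  - exact: integrableD (i1 1) ip.
have iZ (c : R) (f : V -> R) : k.-integrable setT (EFin \o f) ->
    k.-integrable setT (EFin \o (fun z => c * f z)).
  by move=> fi; have := integrableZl measurableT c fi.
have [x0|x0] := eqVneq x 0.
  rewrite x0 normr0 powR0 ?add0r; last by rewrite gt_eqF//; lra.
  under eq_integral do rewrite add0r.
  rewrite -[leLHS]fineK; last exact: integrable_fin_num ip.
  rewrite lee_fin ler_peMl ?Rintegral_ge0//; last by lra.
have xp0 : 0 < `|x| by rewrite normr_gt0.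
(* homogeneity reduces the pointwise inequality to the case [x = 1] *)
have ptw z : `|x + q z| `^ p <=
    (`|x| `^ p + (p * `|x| `^ p / x) * q z) + 4 * `|q z| `^ p.
  have -> : `|x + q z| `^ p = `|x| `^ p * `|1 + q z / x| `^ p.
    by rewrite -powRM// -normrM mulrDr mulr1 mulrC divfK.
  have -> : `|q z| `^ p = `|x| `^ p * `|q z / x| `^ p.
    by rewrite -powRM// -normrM mulrC divfK.
  apply: (le_trans (ler_wpM2l (powR_ge0 _ _) (powRD_le_add (q z / x) p1 p2))).
  by rewrite le_eqVlt; apply/orP; left; apply/eqP; field.
have ilin : k.-integrable setT (EFin \o (fun z =>
    (`|x| `^ p + (p * `|x| `^ p / x) * q z) + 4 * `|q z| `^ p)).
  have i2 := integrableD measurableT (i1 (`|x| `^ p)) (iZ (p * `|x| `^ p / x) _ iq).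
  exact: (integrableD measurableT i2 (iZ 4 _ ip)).
apply: (@le_trans _ _ (\int[k]_z
    ((`|x| `^ p + (p * `|x| `^ p / x) * q z) + 4 * `|q z| `^ p)%:E)%E).
  apply: ge0_le_integral => //.
  - by apply: measurable_power_norm; exact: measurable_funD.
  - by case/integrableP : ilin.
  - by move=> z _; rewrite lee_fin ptw.
rewrite -[leLHS]fineK; last exact: integrable_fin_num ilin.
rewrite lee_fin -[leLHS]/(\int[k]_z
    ((`|x| `^ p + (p * `|x| `^ p / x) * q z) + 4 * `|q z| `^ p)).
rewrite RintegralD//; last 2 first.
- exact: integrableD (i1 (`|x| `^ p)) (iZ (p * `|x| `^ p / x) _ iq).
- exact: iZ ip.
rewrite RintegralD//; last exact: iZ iq.
rewrite !RintegralZl// q0 mulr0 addr0 Rintegral_cst//.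
rewrite [X in _ * fine X](_ : _ = 1%E) ?mulr1//.
exact: probability_setT.
Qed.

(** Given the weights and the first sample, the second sample is added to a
    shifted base point; since the excess is uniform in the base point, the two
    contributions add up, and homogeneity produces the p-th powers of the
    weights. *)
Lemma moment_excess_collision d (T : measurableType d) (P : probability T R)
    d' (V : measurableType d') (op : T * (V * V) -> V)
    (mop : measurable_fun setT op) (q : V -> R) (L M : T -> R)
    (k k' : probability V R) (A A' l r : R) :
  1 < p -> measurable_fun setT q ->
  measurable_fun setT L -> measurable_fun setT M ->
  (forall w, 0 <= L w) -> (forall w, 0 <= M w) ->
  (forall w x y, q (op (w, (x, y))) = L w * q x + M w * q y) ->
  (\int[P]_w (L w `^ p)%:E = l%:E)%E -> (\int[P]_w (M w `^ p)%:E = r%:E)%E ->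
  0 <= A -> 0 <= A' ->
  moment_excess q k A -> moment_excess q k' A' ->
  moment_excess q (collision P mop k k') (l * A + r * A').
Proof.
move=> p1 mq mL mM L0 M0 qop El Er A0 A'0 kA kA' x.
rewrite ge0_integral_collision//; last first.
  by apply: measurable_power_norm; exact: measurable_funD.
have inner w : (\int[independent_pair k k']_z (`|x + q (op (w, z))| `^ p)%:E <=
    (`|x| `^ p + L w `^ p * A + M w `^ p * A')%:E)%E.
  have mz : measurable_fun setT
      (fun z : V * V => (`|x + (L w * q z.1 + M w * q z.2)| `^ p)%:E).
    apply: measurable_power_norm; apply: measurable_funD => //.
    by apply: measurable_funD; apply: measurable_funM => //;
      exact: measurableT_comp.
  under eq_integral do rewrite [X in op (w, X)]surjective_pairing qop.
  rewrite [leLHS](@fubini_tonelli1 _ _ _ _ _ k k' _ mz)//.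
  apply: (@le_trans _ _ (\int[k]_y (`|x + L w * q y| `^ p + M w `^ p * A')%:E)%E).
    apply: ge0_le_integral => //.
    - by move=> y _; apply: integral_ge0 => z _; rewrite lee_fin powR_ge0.
    - exact: (measurable_fun_fubini_tonelli_F _ mz).
    - apply/measurable_EFinP; apply: measurable_funD => //.
      apply/measurable_EFinP/measurable_power_norm; apply: measurable_funD => //.
      exact: measurable_funM.
    - move=> y _; rewrite /fubini_F/=.
      under eq_integral do rewrite addrA.
      exact: moment_excess_scale.
  under eq_integral do rewrite EFinD.
  rewrite ge0_integralD//; last 2 first.
  - apply: measurable_power_norm; apply: measurable_funD => //.
    exact: measurable_funM.
  - by move=> y _; rewrite lee_fin mulr_ge0// powR_ge0.
  rewrite integral_cst// [X in (_ + _ * X)%E](_ : _ = 1%E); last first.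
    exact: probability_setT.
  rewrite mule1 EFinD leeD2r//.
  exact: moment_excess_scale.
have mLp : measurable_fun setT (fun w => L w `^ p).
  exact: measurableT_comp (measurable_powR p) mL.
have mMp : measurable_fun setT (fun w => M w `^ p).
  exact: measurableT_comp (measurable_powR p) mM.
apply: (@le_trans _ _
    (\int[P]_w (`|x| `^ p + L w `^ p * A + M w `^ p * A')%:E)%E).
  apply: ge0_le_integral => //.
  - by move=> w _; apply: integral_ge0 => z _; rewrite lee_fin powR_ge0.
  - apply: (@measurable_fun_fubini_tonelli_F _ _ _ _ _ (independent_pair k k')
      (fun u => (`|x + q (op u)| `^ p)%:E)) => //.
    apply: measurable_power_norm; apply: measurable_funD => //.
    exact: (measurableT_comp mq mop).
  - apply/measurable_EFinP.
    by apply: measurable_funD; [apply: measurable_funD => //|];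
      exact: measurable_funM.
under eq_integral do rewrite !EFinD !EFinM.
rewrite ge0_integralD//; last 4 first.
- by move=> w _; rewrite -EFinM -EFinD lee_fin addr_ge0 ?mulr_ge0 ?powR_ge0.
- apply: emeasurable_funD => //.
  by under eq_fun do rewrite -EFinM; apply/measurable_EFinP; exact: measurable_funM.
- by move=> w _; rewrite -EFinM lee_fin mulr_ge0 ?powR_ge0.
- by under eq_fun do rewrite -EFinM; apply/measurable_EFinP; exact: measurable_funM.
rewrite ge0_integralD//; last 2 first.
- by move=> w _; rewrite -EFinM lee_fin mulr_ge0 ?powR_ge0.
- by under eq_fun do rewrite -EFinM; apply/measurable_EFinP; exact: measurable_funM.
rewrite integral_cst// [X in (_ * X)%E](_ : _ = 1%E); last first.
  exact: probability_setT.
have Zr (f : T -> R) (c : R) : measurable_fun setT f -> (forall w, 0 <= f w) ->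
    0 <= c ->
    (\int[P]_w ((f w)%:E * c%:E) = \int[P]_w (f w)%:E * c%:E)%E.
  move=> mf f0 c0; apply: ge0_integralZr => //; first exact/measurable_EFinP.
  by move=> w _; rewrite lee_fin.
rewrite mule1 !Zr//; try by move=> w; exact: powR_ge0.
by rewrite El Er -!EFinM -!EFinD lee_fin addrA.
Qed.

Lemma moment_excess_mixture d (V : measurableType d) (q : V -> R)
    (w : nat -> {nonneg R}) (m : nat -> probability V R) (A : nat -> R) (B : R) :
  measurable_fun setT q ->
  (\sum_(0 <= n <oo) ((w n)%:num)%:E = 1)%E ->
  (forall n, moment_excess q (m n) (A n)) ->
  (forall N, \sum_(0 <= n < N) (w n)%:num * A n <= B) ->
  moment_excess q (mixture w m) B.
Proof.
move=> mq w1 mA AB x.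
have mx : measurable_fun setT (fun z => (`|x + q z| `^ p)%:E).
  by apply: measurable_power_norm; exact: measurable_funD.
rewrite ge0_integral_mixture//.
apply: lime_le.
  apply: is_cvg_nneseries => n _ _; rewrite mule_ge0// ?lee_fin//.
  by apply: integral_ge0 => z _; rewrite lee_fin powR_ge0.
near=> N.
apply: (@le_trans _ _ (\sum_(0 <= n < N) ((w n)%:num * (`|x| `^ p + A n))%:E)%E).
  apply: lee_sum => n _; rewrite EFinM lee_wpmul2l// ?lee_fin//.
  exact: mA.
rewrite sumEFin lee_fin.
under eq_bigr do rewrite mulrDr.
rewrite big_split/= lerD// -mulr_suml ler_piMl ?powR_ge0//.
rewrite -lee_fin -sumEFin -w1.
by apply: nneseries_lim_ge => n _ _; rewrite lee_fin.
Unshelve. all: by end_near.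
Qed.

End moment_excess.

(** * The sequence of the Wild expansion *)

Section uniform_mixture.
Context d (T : measurableType d) (R : realType).
Variables (n : nat) (m : nat -> probability T R).

(** A finite average is encoded as a countable mixture, by weights vanishing
    beyond [n]. *)
Definition uniform_weight (j : nat) : {nonneg R} :=
  if (j <= n)%N then (n.+1%:R^-1)%:nng else 0%:nng.

Lemma sum_uniform_weight (u : nat -> R) (N : nat) : (n < N)%N ->
  \sum_(0 <= j < N) (uniform_weight j)%:num * u j =
  n.+1%:R^-1 * \sum_(j < n.+1) u j.
Proof.
move=> nN; rewrite (big_cat_nat (n := n.+1))//= [X in _ + X]big_nat_cond.
rewrite [X in _ + X]big1 ?addr0; last first.
  move=> j /andP[/andP[nj _] _].
  by rewrite /uniform_weight leqNgt nj mul0r.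
rewrite big_mkord mulr_sumr; apply: eq_bigr => j _.
by rewrite /uniform_weight -ltnS ltn_ord.
Qed.

Lemma uniform_weight_sum1 :
  (\sum_(0 <= j <oo) ((uniform_weight j)%:num)%:E = 1)%E.
Proof.
apply/cvg_lim => //; apply: cvg_near_cst; near=> N.
rewrite sumEFin; congr EFin.
under eq_bigr do rewrite -[(uniform_weight _)%:num]mulr1.
rewrite sum_uniform_weight; last by near: N; exact: nbhs_infty_gt.
by rewrite sumr_const card_ord mulVf// pnatr_eq0.
Unshelve. all: by end_near.
Qed.

Lemma Rintegral_uniform_mixture (f : T -> R) : bounded_measurable f ->
  \int[mixture uniform_weight m]_x f x =
  n.+1%:R^-1 * \sum_(j < n.+1) \int[m j]_x f x.
Proof.
move=> bf; have H := @cvg_Rintegral_mixture _ _ _ _ m uniform_weight_sum1 _ bf.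
suff H2 : \sum_(0 <= k < N) (uniform_weight k)%:num * \int[m k]_x f x
    @[N --> \oo] --> n.+1%:R^-1 * \sum_(j < n.+1) \int[m j]_x f x.
  exact: (cvg_unique _ H H2).
apply: cvg_near_cst; near=> N.
by rewrite sum_uniform_weight//; near: N; exact: nbhs_infty_gt.
Unshelve. all: by end_near.
Qed.

Lemma Cintegral_uniform_mixture (f : T -> R[i]) : Cbounded_measurable f ->
  n.+1%:R * Cintegral (mixture uniform_weight m) setT f =
  \sum_(j < n.+1) Cintegral (m j) setT f.
Proof.
move=> [rf jf].
have Ren k : complex.Re (k%:R : R[i]) = k%:R.
  by elim: k => // k IH; rewrite -natr1 ReD IH natr1.
have Imn k : complex.Im (k%:R : R[i]) = 0.
  by elim: k => // k IH; rewrite -natr1 ImD IH addr0.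
have n0 : n.+1%:R != 0 :> R by rewrite pnatr_eq0.
apply: complexP; rewrite ?ReM ?ImM Ren Imn mul0r ?subr0 ?addr0 ?Re_sum ?Im_sum/=.
  by rewrite Rintegral_uniform_mixture// mulrA divff// mul1r.
by rewrite Rintegral_uniform_mixture// mulrA divff// mul1r.
Qed.

End uniform_mixture.

Section wild_sequence.
Context d (T : measurableType d) (R : realType) (P : probability T R).
Context d' (V : measurableType d') (op : T * (V * V) -> V).
Hypothesis mop : measurable_fun setT op.
Variable k0 : probability V R.

(** Each term of the Wild sequence depends on all the earlier ones, so the
    recursion builds the list of the first terms. Capping the index [j] by [n']
    only affects terms of weight zero, and keeps it within the list. *)
Fixpoint wild_prefix n : seq (probability V R) :=
  if n is n'.+1 then
    let s := wild_prefix n' in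
    rcons s (mixture (uniform_weight R n') (fun j =>
      collision P mop (nth k0 s (minn j n')) (nth k0 s (n' - j))))
  else [:: k0].

Definition wild n : probability V R := nth k0 (wild_prefix n) n.

Lemma size_wild_prefix n : size (wild_prefix n) = n.+1.
Proof. by elim: n => //= n IH; rewrite size_rcons IH. Qed.

Lemma nth_wild_prefix n j : (j <= n)%N -> nth k0 (wild_prefix n) j = wild j.
Proof.
elim: n => [|n IH]; first by rewrite leqn0 => /eqP ->.
rewrite leq_eqVlt => /predU1P[-> //|]; rewrite ltnS => jn.
by rewrite /= nth_rcons size_wild_prefix ltnS jn IH.
Qed.

Lemma wildS n : wild n.+1 = mixture (uniform_weight R n) (fun j =>
  collision P mop (wild (minn j n)) (wild (n - j))).
Proof.
rewrite /wild /= nth_rcons size_wild_prefix ltnn eqxx.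
congr mixture; apply/funext => j.
by rewrite !nth_wild_prefix ?geq_minr ?leq_subr.
Qed.

Lemma fourier_wildS (L M : T -> R) (q : V -> R) (mq : measurable_fun setT q) :
  (forall w x y, q (op (w, (x, y))) = L w * q x + M w * q y) ->
  forall n xi,
  let r j := fourier_stieltjes (image_probability (wild j) mq) in
  n.+1%:R * r n.+1 xi =
  \sum_(j < n.+1) Cexpectation P (fun w => r j (L w * xi) * r (n - j)%N (M w * xi)).
Proof.
move=> qop n xi r.
have bc : Cbounded_measurable (fun v => Cexp (Complex 0 (xi * q v))).
  by apply: Cbounded_measurable_cis; exact: measurable_funM.
have rE (k : probability V R) : fourier_stieltjes (image_probability k mq) xi =
    Cintegral k setT (fun v => Cexp (Complex 0 (xi * q v))).
  rewrite /fourier_stieltjes Cintegral_image//.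
  by apply: Cbounded_measurable_cis; exact: mulrl_measurable.
rewrite /r rE wildS Cintegral_uniform_mixture//; apply: eq_bigr => j _.
rewrite -rE (fourier_collision P mop _ _ mq qop).
by rewrite (minn_idPl _)// -ltnS.
Qed.

Section moments.
Variables (p l r A0 : R) (L M : T -> R) (q : V -> R).

(** The excess bounds inherit the Wild recursion, see [sum_wild_moment]; its
    solution is [A0] times the coefficient of [z ^+ n] in the binomial series
    of [(1 - z) `^ (- (l + r))]. *)
Definition wild_moment n : R :=
  A0 * \prod_(k < n) ((k%:R + (l + r)) / k.+1%:R).

Lemma wild_momentS n :
  n.+1%:R * wild_moment n.+1 = (n%:R + (l + r)) * wild_moment n.
Proof.
rewrite /wild_moment big_ord_recr/=; set Q := \prod_(_ < _) _.
have N0 : n.+1%:R != 0 :> R by rewrite pnatr_eq0.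
by move: (n.+1%:R) (n%:R) N0 => N a N0; field.
Qed.

Lemma sum_wild_moment n :
  (l + r) * \sum_(j < n.+1) wild_moment j = n.+1%:R * wild_moment n.+1.
Proof.
elim: n => [|n IH]; first by rewrite big_ord1 wild_momentS add0r.
by rewrite big_ord_recr/= mulrDr IH [RHS]wild_momentS [RHS]mulrDl.
Qed.

Hypotheses (A00 : 0 <= A0) (l0 : 0 <= l) (r0 : 0 <= r).

Lemma wild_moment_ge0 n : 0 <= wild_moment n.
Proof.
by rewrite mulr_ge0// prodr_ge0// => k _; rewrite divr_ge0// !addr_ge0.
Qed.

Lemma moment_excess_wild : 1 < p -> measurable_fun setT q ->
  measurable_fun setT L -> measurable_fun setT M ->
  (forall w, 0 <= L w) -> (forall w, 0 <= M w) ->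
  (forall w x y, q (op (w, (x, y))) = L w * q x + M w * q y) ->
  (\int[P]_w (L w `^ p)%:E = l%:E)%E -> (\int[P]_w (M w `^ p)%:E = r%:E)%E ->
  moment_excess p q k0 A0 ->
  forall n, moment_excess p q (wild n) (wild_moment n).
Proof.
move=> p1 mq mL mM L0 M0 qop El Er k0A n.
elim/ltn_ind: n => -[_|n IH].
  by rewrite /wild_moment big_ord0 mulr1.
rewrite wildS.
apply: (moment_excess_mixture (A := fun j =>
  l * wild_moment (minn j n) + r * wild_moment (n - j))) => //.
- exact: uniform_weight_sum1.
- move=> j; apply: (moment_excess_collision mop p1 mq mL mM L0 M0 qop El Er).
  + exact: wild_moment_ge0.
  + exact: wild_moment_ge0.
  + by apply: IH; rewrite ltnS geq_minr.
  + by apply: IH; rewrite ltnS leq_subr.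
move=> N.
have le1 : \sum_(0 <= j < N) (uniform_weight R n j)%:num *
      (l * wild_moment (minn j n) + r * wild_moment (n - j)) <=
    \sum_(0 <= j < N + n.+1) (uniform_weight R n j)%:num *
      (l * wild_moment (minn j n) + r * wild_moment (n - j)).
  rewrite [leRHS](big_cat_nat (n := N)) ?leq_addr//=.
  rewrite lerDl; apply: sumr_ge0 => j _.
  by rewrite mulr_ge0// addr_ge0// mulr_ge0// wild_moment_ge0.
apply: (le_trans le1); rewrite sum_uniform_weight ?addnS ?ltnS ?leq_addl//.
rewrite ler_pdivrMl// -sum_wild_moment.
rewrite big_split/= -[X in X + _]mulr_sumr -[X in _ + X]mulr_sumr mulrDl lerD//.
  rewrite ler_wpM2l// le_eqVlt; apply/orP; left; apply/eqP.
  by apply: eq_bigr => j _; rewrite (minn_idPl _)// -ltnS.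
rewrite ler_wpM2l// le_eqVlt; apply/orP; left; apply/eqP.
rewrite [RHS](reindex_inj rev_ord_inj)/=.
by apply: eq_bigr => j _; rewrite subSS.
Qed.

End moments.

End wild_sequence.

(** * Convergence of the Wild sums to the solution *)

(** The component of [g s] along the final value [g t] is a real function of
    [s], whose derivative is at most [normc (g t) * b' s]. *)
Lemma normc_le_of_derive (R : realType) (g g' : R -> R[i]) (b b' : R -> R)
    (t : R) : 0 <= t ->
  (forall s, 0 < s -> is_Cderive g s (g' s)) ->
  (forall s, is_derive s (1 : R) b (b' s)) ->
  (forall s, 0 < s -> normc (g' s) <= b' s) ->
  Ccvg_at_right g 0 (g 0) -> g 0 = 0 -> b 0 = 0 -> 0 <= b t ->
  normc (g t) <= b t.
Proof.
move=> + dg db g'b [rg jg] g0 b0 bt0; rewrite le_eqVlt => /predU1P[<-|t0].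
  by rewrite g0 b0 normc0.
have [n0|n0] := lerP (normc (g t)) 0; first exact: le_trans bt0.
pose h s := complex.Re (g t) * complex.Re (g s) +
  complex.Im (g t) * complex.Im (g s) - normc (g t) * b s.
have cb s : b x @[x --> s] --> b s.
  by apply: differentiable_continuous; apply/derivable1_diffP; case: (db s).
have dh (s : R) : 0 < s -> is_derive s (1 : R) h (complex.Re (g t) * complex.Re (g' s) +
    complex.Im (g t) * complex.Im (g' s) - normc (g t) * b' s).
  move=> s0; have [dr dj] := dg s s0; have dbs := db s.
  exact: is_derive_eq.
have ch0 : h x @[x --> 0^'+] --> h 0.
  apply: cvgB; first apply: cvgD.
  - by apply: cvgM => //; exact: cvg_cst.
  - by apply: cvgM => //; exact: cvg_cst.
  - by apply: cvgM; [exact: cvg_cst|exact: cvg_at_right_filter].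
have cht : h x @[x --> t^'-] --> h t.
  apply: cvg_at_left_filter.
  by apply: differentiable_continuous; apply/derivable1_diffP; case: (dh t t0).
have dhoo : derivable_oo_LRcontinuous h 0 t.
  split => // x; rewrite in_itv/= => /andP[x0 _].
  by case: (dh x x0).
have ht : h t <= h 0.
  apply: (@ler0_derive1_le_cc _ h 0 t).
  - by move=> x; rewrite in_itv/= => /andP[x0 _]; case: (dh x x0).
  - move=> x; rewrite in_itv/= => /andP[x0 _]; rewrite derive1E.
    case: (dh x x0) => _ ->; rewrite subr_le0.
    by rewrite (le_trans (normc_cauchy_schwarz _ _))// ler_wpM2l ?g'b// ltW.
  - exact: derivable_oo_LRcontinuous_within.
  - by rewrite in_itv/= lexx ltW.
  - by rewrite in_itv/= lexx ltW.
  - exact: ltW.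
move: ht; rewrite /h g0 b0 !mulr0 addr0 subrr -!expr2 -sqr_normcE expr2.
by rewrite subr_le0 ler_pM2l.
Qed.

Lemma sum_triangle (S : nmodType) (F : nat -> nat -> S) N :
  \sum_(n < N) \sum_(j < n.+1) F j (n - j)%N =
  \sum_(j < N) \sum_(k < N - j) F j k.
Proof.
elim: N => [|N IH]; first by rewrite !big_ord0.
rewrite big_ord_recr/= IH.
rewrite [in RHS]big_ord_recr/= subSn// subnn.
rewrite [X in _ + X]big_ord_recr/= subnn addrA; congr (_ + _); last first.
  by rewrite big_ord_recr big_ord0/= add0r.
rewrite -big_split/=; apply: eq_bigr => j _.
by rewrite subSn ?big_ord_recr// ltnW.
Qed.

Lemma normc_real (R : realType) (x : R) : 0 <= x -> normc (x%:C)%C = x.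
Proof. by move=> x0; rewrite /= expr0n/= addr0 sqrtr_sqr ger0_norm. Qed.

Lemma normc_sum (R : realType) n (F : 'I_n -> R[i]) :
  normc (\sum_(j < n) F j) <= \sum_(j < n) normc (F j).
Proof.
elim/big_ind2: _ => [|x a y b xa yb|//]; first by rewrite normc0.
by rewrite (le_trans (le_normcD _ _))// lerD.
Qed.

Section wild_remainder.
Context (R : realType) (w z : R).
Hypotheses (w0 : 0 <= w) (z0 : 0 <= z).

Definition wild_sum (x : nat -> R[i]) (N : nat) : R[i] :=
  \sum_(n < N) ((w * z ^+ n)%:C)%C * x n.

(** The terms missing from the truncated product split into those whose first
    factor has been truncated and those whose second factor has, given an
    untruncated term of the first. *)
Lemma wild_remainder_product (x y : nat -> R[i]) (a b : R[i]) N :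
  normc b <= 1 -> (forall j, normc (x j) <= 1) ->
  normc (a - wild_sum x N) <= z ^+ N ->
  (forall k, (k <= N)%N -> normc (b - wild_sum y k) <= z ^+ k) ->
  normc (a * b - \sum_(n < N) ((w ^+ 2 * z ^+ n)%:C)%C *
                   \sum_(j < n.+1) x j * y (n - j)%N)
    <= z ^+ N * (1 + N%:R * w).
Proof.
move=> b1 x1 aN bk.
have -> : \sum_(n < N) ((w ^+ 2 * z ^+ n)%:C)%C * \sum_(j < n.+1) x j * y (n - j)%N =
    \sum_(j < N) ((w * z ^+ j)%:C)%C * x j * wild_sum y (N - j).
  pose F j k := ((w * z ^+ j)%:C)%C * x j * (((w * z ^+ k)%:C)%C * y k).
  transitivity (\sum_(n < N) \sum_(j < n.+1) F j (n - j)%N).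
    apply: eq_bigr => n _; rewrite mulr_sumr; apply: eq_bigr => j _; rewrite /F.
    have jn : (j <= n)%N by rewrite -ltnS.
    rewrite -[in z ^+ n](subnKC jn) exprD /=.
    rewrite !rmorphM/= rmorphXn/=.
    by ring.
  rewrite sum_triangle; apply: eq_bigr => j _.
  by rewrite /wild_sum mulr_sumr; apply: eq_bigr => k _; rewrite /F.
have -> : a * b - \sum_(j < N) ((w * z ^+ j)%:C)%C * x j * wild_sum y (N - j) =
    (a - wild_sum x N) * b +
    \sum_(j < N) ((w * z ^+ j)%:C)%C * x j * (b - wild_sum y (N - j)).
  under [in RHS]eq_bigr do rewrite mulrBr.
  rewrite sumrB mulrBl [wild_sum x N * b]mulr_suml.
  by rewrite addrA subrK.
rewrite (le_trans (le_normcD _ _))// mulrDr mulr1 lerD//.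
  by rewrite normcM -[leRHS]mulr1 ler_pM ?normc_ge0.
rewrite (le_trans (normc_sum _))//.
apply: (@le_trans _ _ (\sum_(j < N) w * z ^+ N)).
  apply: ler_sum => j _; rewrite !normcM normc_real; last first.
    by rewrite mulr_ge0// exprn_ge0.
  have jN : (j <= N)%N by exact: ltnW.
  rewrite -[in leRHS](subnKC jN) exprD mulrA.
  apply: ler_pM; rewrite ?mulr_ge0 ?normc_ge0 ?exprn_ge0//.
    by rewrite ler_piMr ?mulr_ge0 ?exprn_ge0.
  by rewrite bk ?leq_subr.
rewrite sumr_const card_ord -mulr_natl le_eqVlt; apply/orP; left; apply/eqP.
by ring.
Qed.

End wild_remainder.

Lemma is_derive_onem_expRN_exp (R : realType) n (s : R) :
  is_derive s (1 : R) (fun s => (1 - expR (- s)) ^+ n.+1)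
    (n.+1%:R * ((1 - expR (- s)) ^+ n * expR (- s))).
Proof.
have dz : is_derive s (1 : R) (fun s => 1 - expR (- s)) (expR (- s)).
  by apply: is_derive_eq; rewrite /GRing.scale/=; ring.
rewrite (_ : (fun _ => _) = (fun s : R => 1 - expR (- s)) ^+ n.+1); last first.
  by apply/funext => x; rewrite exprfctE.
apply: is_derive_eq; rewrite /GRing.scale/=.
by rewrite mulrA.
Qed.

Lemma is_derive_power_sum (R : realType) (c : nat -> R) N (s : R) :
  is_derive s (1 : R) (fun s => \sum_(n < N.+1) (1 - expR (- s)) ^+ n * c n)
    (\sum_(n < N) n.+1%:R * ((1 - expR (- s)) ^+ n * expR (- s)) * c n.+1).
Proof.
elim: N => [|N IH].
  rewrite big_ord0 (_ : (fun _ => _) = cst (c 0%N)).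
    exact: is_derive_cst.
  by apply/funext => x; rewrite big_ord1 expr0 mul1r.
rewrite (_ : (fun _ => _) = (fun s => \sum_(n < N.+1) (1 - expR (- s)) ^+ n * c n) \+
    (fun s => (1 - expR (- s)) ^+ N.+1 * c N.+1)); last first.
  by apply/funext => x; rewrite big_ord_recr.
rewrite big_ord_recr/=.
have dX := is_derive_onem_expRN_exp N s.
apply: is_deriveD; apply: is_derive_eq; rewrite /GRing.scale/=.
by ring.
Qed.

Lemma ReZ (R : realType) (x : R) (y : R[i]) :
  complex.Re ((x%:C)%C * y) = x * complex.Re y.
Proof. by rewrite ReM/= mul0r subr0. Qed.

Lemma ImZ (R : realType) (x : R) (y : R[i]) :
  complex.Im ((x%:C)%C * y) = x * complex.Im y.
Proof. by rewrite ImM/= mul0r addr0. Qed.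

Section wild_convergence.
Context d (T : measurableType d) (R : realType) (P : probability T R).
Variables (L M : {RV P >-> R}) (mu0 : probability R R).
Variables (mu : R -> probability R R) (rho : nat -> probability R R).
Hypothesis kinetic : kinetic_solution L M mu0 mu.

Let f (s xi : R) := fourier_stieltjes (mu s) xi.
Let r n xi := fourier_stieltjes (rho n) xi.

Hypothesis rho0 : forall xi, r 0 xi = fourier_stieltjes mu0 xi.
Hypothesis rhoS : forall n xi, n.+1%:R * r n.+1 xi =
  \sum_(j < n.+1) Cexpectation P (fun w => r j (L w * xi) * r (n - j)%N (M w * xi)).

Let mulL_measurable (xi : R) : measurable_fun setT (fun w => L w * xi).
Proof. exact: measurable_funM. Qed.

Let mulM_measurable (xi : R) : measurable_fun setT (fun w => M w * xi).
Proof. exact: measurable_funM. Qed.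

Let bL (m : probability R R) xi :
  Cbounded_measurable (fun w => fourier_stieltjes m (L w * xi)).
Proof.
exact: (Cbounded_measurable_comp (mulL_measurable xi) (Cbounded_measurable_fourier m)).
Qed.

Let bM (m : probability R R) xi :
  Cbounded_measurable (fun w => fourier_stieltjes m (M w * xi)).
Proof.
exact: (Cbounded_measurable_comp (mulM_measurable xi) (Cbounded_measurable_fourier m)).
Qed.

Let one_sub_expRN_ge0 (s : R) : 0 <= s -> 0 <= 1 - expR (- s).
Proof. by move=> s0; rewrite subr_ge0 -expR0 ler_expR oppr_le0. Qed.

Definition wild_partial N (s xi : R) : R[i] :=
  wild_sum (expR (- s)) (1 - expR (- s)) (fun n => r n xi) N.

(** At positive order both sides vanish at time 0, and the derivative of
    [expR t] times the remainder of order [N.+1] is controlled by the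
    remainders of lower order; the bound [(1 - expR (- t)) ^+ N] is the one for
    which this control reproduces itself exactly. *)
Lemma wild_partial_close N (t xi : R) : 0 <= t ->
  normc (f t xi - wild_partial N t xi) <= (1 - expR (- t)) ^+ N.
Proof.
elim/ltn_ind: N t xi => -[_|N IH] t xi t0.
  rewrite /wild_partial /wild_sum big_ord0 subr0 expr0.
  exact: normc_fourier_le1.
have [dk ck k0] := kinetic.
pose g s := (expR s)%:C%C * f s xi - \sum_(n < N.+1) ((1 - expR (- s)) ^+ n)%:C%C * r n xi.
pose b (s : R) := expR s * (1 - expR (- s)) ^+ N.+1.
have expK s : expR s * expR (- s) = 1 :> R by rewrite expRN divff ?gt_eqF ?expR_gt0.
have gE s : g s = (expR s)%:C%C * (f s xi - wild_partial N.+1 s xi).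
  rewrite /g mulrBr; congr (_ - _).
  rewrite /wild_partial /wild_sum mulr_sumr; apply: eq_bigr => n _.
  by rewrite mulrA -rmorphM mulrA expK mul1r.
suff : normc (g t) <= b t.
  by rewrite gE normcM normc_real ?expR_ge0// /b ler_pM2l ?expR_gt0.
pose g' s := (expR s)%:C%C *
  (Cexpectation P (fun w => f s (L w * xi) * f s (M w * xi)) -
   \sum_(n < N) ((expR (- s) ^+ 2 * (1 - expR (- s)) ^+ n)%:C)%C *
     \sum_(j < n.+1) Cexpectation P (fun w => r j (L w * xi) * r (n - j)%N (M w * xi))).
have g'E s : g' s =
    (expR s)%:C%C * Cexpectation P (fun w => f s (L w * xi) * f s (M w * xi)) -
    \sum_(n < N) (n.+1%:R * ((1 - expR (- s)) ^+ n * expR (- s)))%:C%C * r n.+1 xi.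
  rewrite /g' mulrBr; congr (_ - _); rewrite mulr_sumr; apply: eq_bigr => n _.
  rewrite -rhoS (_ : n.+1%:R = (n.+1%:R)%:C%C :> R[i]); last by rewrite rmorph_nat.
  rewrite !mulrA -!rmorphM; congr (_%:C%C * _).
  rewrite /= expr2 !mulrA expK mul1r; ring.
pose b' s : R := expR s * ((1 - expR (- s)) ^+ N * (1 + N%:R * expR (- s))).
apply: (@normc_le_of_derive _ g g' b b') => //.
- move=> s s0; have [dr dj] := dk s xi s0.
  rewrite ReD ReN in dr; rewrite ImD ImN in dj.
  have dRe := is_derive_power_sum (fun n => complex.Re (r n xi)) N s.
  have dIm := is_derive_power_sum (fun n => complex.Im (r n xi)) N s.
  rewrite g'E; split.
    under eq_fun do rewrite /g ReD ReN ReZ Re_sum.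
    under eq_fun do under eq_bigr do rewrite ReZ.
    rewrite ReD ReN ReZ Re_sum; under eq_bigr do rewrite ReZ.
    by apply: is_derive_eq; rewrite /GRing.scale/=; ring.
  under eq_fun do rewrite /g ImD ImN ImZ Im_sum.
  under eq_fun do under eq_bigr do rewrite ImZ.
  rewrite ImD ImN ImZ Im_sum; under eq_bigr do rewrite ImZ.
  by apply: is_derive_eq; rewrite /GRing.scale/=; ring.
- move=> s; rewrite /b /b'; have dX := is_derive_onem_expRN_exp N s.
  apply: is_derive_eq; rewrite /GRing.scale/=.
  by rewrite exprS -natr1; ring.
- move=> s s0; rewrite /g' normcM normc_real ?expR_ge0// /b' ler_pM2l ?expR_gt0//.
  have bQ n : Cbounded_measurable (fun w => \sum_(j < n.+1)
      r j (L w * xi) * r (n - j)%N (M w * xi)).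
    by apply: (@Cbounded_measurable_sum _ _ _ n.+1 (fun j w =>
      r j (L w * xi) * r (n - j)%N (M w * xi))) => j;
      apply: Cbounded_measurableM; [exact: bL|exact: bM].
  have bZ n : Cbounded_measurable (fun w =>
      ((expR (- s) ^+ 2 * (1 - expR (- s)) ^+ n)%:C)%C * \sum_(j < n.+1)
      r j (L w * xi) * r (n - j)%N (M w * xi)).
    by apply: Cbounded_measurableM => //; exact: Cbounded_measurable_cst.
  have bF : Cbounded_measurable (fun w => f s (L w * xi) * f s (M w * xi)).
    by apply: Cbounded_measurableM; [exact: bL|exact: bM].
  have bS := Cbounded_measurable_sum N bZ.
  rewrite (_ : _ - _ = Cintegral P setT (fun w =>
      f s (L w * xi) * f s (M w * xi) - \sum_(n < N)
      ((expR (- s) ^+ 2 * (1 - expR (- s)) ^+ n)%:C)%C * \sum_(j < n.+1)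
      r j (L w * xi) * r (n - j)%N (M w * xi))); last first.
    rewrite CintegralB//; congr (_ - _).
    rewrite (@Cintegral_sum _ _ _ P N (fun n w =>
      ((expR (- s) ^+ 2 * (1 - expR (- s)) ^+ n)%:C)%C * \sum_(j < n.+1)
      r j (L w * xi) * r (n - j)%N (M w * xi)))//; apply: eq_bigr => n _.
    rewrite CintegralZl//; congr (_ * _).
    rewrite (@Cintegral_sum _ _ _ P n.+1 (fun j w =>
      r j (L w * xi) * r (n - j)%N (M w * xi)))// => j.
    by apply: Cbounded_measurableM; [exact: bL|exact: bM].
  apply: normc_Cintegral_le; first exact: Cbounded_measurableB.
  move=> w; apply: (wild_remainder_product (expR_ge0 (- s))
    (one_sub_expRN_ge0 (ltW s0)) (x := fun n => r n (L w * xi))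
    (y := fun n => r n (M w * xi))).
  + exact: normc_fourier_le1.
  + by move=> j; exact: normc_fourier_le1.
  + by apply: IH => //; exact: ltW.
  + by move=> k kN; apply: IH => //; exact: ltW.
- have cz (h : nat -> R) : {for 0, continuous (fun s : R =>
      \sum_(n < N.+1) (1 - expR (- s)) ^+ n * h n)}.
    have := is_derive_power_sum h N 0.
    by case=> dh _; apply/differentiable_continuous/derivable1_diffP.
  have ce : expR x @[x --> 0^'+] --> expR (0 : R).
    by apply: cvg_at_right_filter; exact: continuous_expR.
  have [cRe cIm] := ck xi.
  split.
    have gRe s : complex.Re (g s) = expR s * complex.Re (f s xi) -
        \sum_(n < N.+1) (1 - expR (- s)) ^+ n * complex.Re (r n xi).
      rewrite /g ReD ReN ReZ Re_sum; congr (_ - _).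
      by apply: eq_bigr => n _; rewrite ReZ.
    rewrite gRe; have -> : (fun s => complex.Re (g s)) =
        (fun s => expR s * complex.Re (f s xi) -
          \sum_(n < N.+1) (1 - expR (- s)) ^+ n * complex.Re (r n xi)).
      by apply/funext => s; rewrite gRe.
    apply: cvgB; first by apply: cvgM => //; rewrite /f k0.
    by apply: cvg_at_right_filter; exact: (cz (fun n => complex.Re (r n xi))).
  have gIm s : complex.Im (g s) = expR s * complex.Im (f s xi) -
      \sum_(n < N.+1) (1 - expR (- s)) ^+ n * complex.Im (r n xi).
    rewrite /g ImD ImN ImZ Im_sum; congr (_ - _).
    by apply: eq_bigr => n _; rewrite ImZ.
  rewrite gIm; have -> : (fun s => complex.Im (g s)) =
        (fun s => expR s * complex.Im (f s xi) -
          \sum_(n < N.+1) (1 - expR (- s)) ^+ n * complex.Im (r n xi)).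
      by apply/funext => s; rewrite gIm.
  apply: cvgB; first by apply: cvgM => //; rewrite /f k0.
  by apply: cvg_at_right_filter; exact: (cz (fun n => complex.Im (r n xi))).
- rewrite gE.
  rewrite /wild_partial /wild_sum oppr0 expR0 subrr big_ord_recl expr0 mulr1.
  rewrite /f k0 -rho0 big1 ?addr0; last first.
    by move=> i _; rewrite /= exprS mul0r mulr0 mul0r.
  by rewrite !rmorph1 !mul1r subrr.
- by rewrite /b oppr0 expR0 subrr exprS mul0r mulr0.
- by rewrite /b mulr_ge0 ?expR_ge0 ?exprn_ge0 ?one_sub_expRN_ge0.
Qed.

End wild_convergence.

Section geometric_mixture.
Context (R : realType).

Definition geometric_weight (t : R) (n : nat) : {nonneg R} :=
  NngNum (mulr_ge0 (expR_ge0 (- t)) (exprn_ge0 n (normr_ge0 (1 - expR (- t))))).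

Lemma geometric_weightE t n : 0 <= t ->
  (geometric_weight t n)%:num = expR (- t) * (1 - expR (- t)) ^+ n.
Proof.
move=> t0; rewrite /= ger0_norm// subr_ge0 -expR0 ler_expR.
by rewrite oppr_le0.
Qed.

Lemma cvg_onem_expRN_exp (t : R) : 0 <= t ->
  (1 - expR (- t)) ^+ n @[n --> \oo] --> (0 : R).
Proof.
move=> t0; apply: cvg_expr; rewrite ger0_norm.
  by rewrite ltrBlDr ltrDl expR_gt0.
by rewrite subr_ge0 -expR0 ler_expR oppr_le0.
Qed.

Lemma sum_geometric_weight (t : R) N : 0 <= t ->
  \sum_(0 <= n < N) (geometric_weight t n)%:num = 1 - (1 - expR (- t)) ^+ N.
Proof.
move=> t0; elim: N => [|N IH]; first by rewrite big_geq// expr0 subrr.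
by rewrite big_nat_recr//= IH -/(_%:num) geometric_weightE// exprS; ring.
Qed.

Lemma geometric_weight_sum1 (t : R) : 0 <= t ->
  (\sum_(0 <= n <oo) ((geometric_weight t n)%:num)%:E = 1)%E.
Proof.
move=> t0; apply/cvg_lim => //.
rewrite (_ : (fun _ => _) = EFin \o (fun N => 1 - (1 - expR (- t)) ^+ N)); last first.
  by apply/funext => N; rewrite /= sumEFin sum_geometric_weight.
apply: cvg_EFin; first by near=> N.
rewrite -[X in _ --> X]subr0.
by apply: cvgB; [exact: cvg_cst|exact: cvg_onem_expRN_exp].
Unshelve. all: by end_near.
Qed.

(** The sum is [expR (- t)] times a partial sum of [A0 * (1 - z) `^ (- (l + r))]
    at [z = 1 - expR (- t)], that is of [A0 * expR ((l + r) * t)]. The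
    recursion makes the derivative in [t] of the partial sum at most [l + r]
    times the next one, so that its product with [expR (- ((l + r) * t))] is
    nonincreasing. *)
Lemma sum_geometric_wild_moment (l r A0 t : R) N :
  0 <= A0 -> 0 <= l -> 0 <= r -> 0 <= t ->
  \sum_(0 <= n < N) (geometric_weight t n)%:num * wild_moment l r A0 n <=
  A0 * expR (- (t * (1 - (l + r)))).
Proof.
move=> A00 l0 r0 t0.
pose A := wild_moment l r A0.
have Age n : 0 <= A n by exact: wild_moment_ge0.
have z0 s : 0 <= s -> 0 <= 1 - expR (- s) :> R.
  by move=> s0; rewrite subr_ge0 -expR0 ler_expR oppr_le0.
pose h (s : R) := expR (- ((l + r) * s)) * \sum_(n < N.+1) (1 - expR (- s)) ^+ n * A n.
pose D (s : R) := \sum_(n < N) n.+1%:R * ((1 - expR (- s)) ^+ n * expR (- s)) * A n.+1.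
have dh (s : R) : is_derive s (1 : R) h (expR (- ((l + r) * s)) *
    (D s - (l + r) * \sum_(n < N.+1) (1 - expR (- s)) ^+ n * A n)).
  have dS := is_derive_power_sum A N s; rewrite -/(D s) in dS.
  by apply: is_derive_eq; rewrite /GRing.scale/=; ring.
have DE (s : R) : D s = (l + r) * \sum_(n < N) (1 - expR (- s)) ^+ n * A n -
    N%:R * A N * (1 - expR (- s)) ^+ N.
  rewrite /D; elim: N {h D dh} => [|K IH]; first by rewrite !big_ord0 mulr0 !mul0r subr0.
  rewrite big_ord_recr/= IH [in RHS]big_ord_recr/=.
  have := wild_momentS l r A0 K; rewrite -/(A _) -/(A _) => AE.
  rewrite exprS; move: (A K) (A K.+1) AE => a a' AE.
  apply/eqP; rewrite -subr_eq0; apply/eqP.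
  transitivity ((K.+1%:R * a' - (K%:R + (l + r)) * a) * (1 - expR (- s)) ^+ K).
    by ring.
  by rewrite AE subrr mul0r.
have Dle (s : R) : 0 <= s ->
    D s <= (l + r) * \sum_(n < N.+1) (1 - expR (- s)) ^+ n * A n.
  move=> s0; rewrite DE big_ord_recr/= mulrDr.
  have zN0 := exprn_ge0 N (z0 s s0); have AN0 := Age N.
  have lr0 : 0 <= l + r by exact: addr_ge0.
  rewrite lerBlDr -addrA lerDl addr_ge0//.
    exact: mulr_ge0 lr0 (mulr_ge0 zN0 AN0).
  exact: mulr_ge0 (mulr_ge0 (ler0n R N) AN0) zN0.
have ht : h t <= h 0.
  move: t0; rewrite le_eqVlt => /predU1P[<-//|t0].
  apply: (@ler0_derive1_le_cc _ h 0 t).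
  - by move=> x _; case: (dh x).
  - move=> x; rewrite in_itv/= => /andP[x0 _]; rewrite derive1E.
    case: (dh x) => _ ->; rewrite mulr_ge0_le0 ?expR_ge0//.
    by rewrite subr_le0 Dle// ltW.
  - apply: continuous_subspaceT => x.
    by apply/differentiable_continuous/derivable1_diffP; case: (dh x).
  - by rewrite in_itv/= lexx ltW.
  - by rewrite in_itv/= lexx ltW.
  - exact: ltW.
have h0 : h 0 = A0.
  rewrite /h mulr0 oppr0 expR0 mul1r subrr big_ord_recl expr0 mul1r big1 ?addr0.
    by rewrite /A /wild_moment big_ord0 mulr1.
  by move=> i _; rewrite exprS !mul0r.
rewrite h0 /h expRN mulrC ler_pdivrMr ?expR_gt0// in ht.
rewrite mulrBr mulr1 opprB expRD.
apply: (@le_trans _ _ (expR (- t) * \sum_(n < N.+1) (1 - expR (- t)) ^+ n * A n)).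
  rewrite big_mkord [X in _ <= _ * X]big_ord_recr/= mulrDr mulr_sumr.
  rewrite [X in X <= _](_ : _ =
      \sum_(n < N) expR (- t) * ((1 - expR (- t)) ^+ n * A n)); last first.
    by apply: eq_bigr => n _; rewrite ger0_norm ?z0// -mulrA.
  by rewrite lerDl mulr_ge0 ?expR_ge0// mulr_ge0// exprn_ge0// z0.
rewrite [t * _]mulrC [expR _ * expR (- t)]mulrC mulrCA ler_wpM2l ?expR_ge0//.
Qed.

End geometric_mixture.

(** The partial Wild sums converge to the transform of the mixture by its
    definition, and to that of the solution by [wild_partial_close]. The laws
    [k n] live on any space with an observable, so this gives the Wild
    representation of a solution and identifies the coordinates of a mixture
    on the plane alike. *)
Lemma fourier_geometric_mixture d (T : measurableType d) (R : realType)
    (P : probability T R) (L M : {RV P >-> R}) (mu0 : probability R R)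
    (mu : R -> probability R R) d' (V : measurableType d')
    (k : nat -> probability V R) (q : V -> R) (mq : measurable_fun setT q)
    (t : R) :
  kinetic_solution L M mu0 mu ->
  let r n := fourier_stieltjes (image_probability (k n) mq) in
  (forall xi, r 0%N xi = fourier_stieltjes mu0 xi) ->
  (forall n xi, n.+1%:R * r n.+1 xi =
    \sum_(j < n.+1) Cexpectation P (fun w => r j (L w * xi) * r (n - j)%N (M w * xi))) ->
  0 <= t ->
  fourier_stieltjes (image_probability (mixture (geometric_weight t) k) mq) =1
  fourier_stieltjes (mu t).
Proof.
move=> kin r r0 rS t0 xi.
have close N := wild_partial_close kin (rho := fun n => image_probability (k n) mq)
  r0 rS N xi t0.
have bc : Cbounded_measurable (fun v => Cexp (Complex 0 (xi * q v))).
  by apply: Cbounded_measurable_cis; exact: measurable_funM.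
have rE (m : probability V R) : fourier_stieltjes (image_probability m mq) xi =
    Cintegral m setT (fun v => Cexp (Complex 0 (xi * q v))).
  rewrite /fourier_stieltjes Cintegral_image//.
  by apply: Cbounded_measurable_cis; exact: mulrl_measurable.
have [bRe bIm] := bc.
have w1 := geometric_weight_sum1 t0.
have cz := cvg_onem_expRN_exp t0.
pose S N := wild_partial (fun n => image_probability (k n) mq) N t xi.
have cvgS (p : R[i] -> R) (u : nat -> R) (x : R) :
    (forall z, `|p z| <= normc z) -> (forall z z', p (z - z') = p z - p z') ->
    (forall N, u N = p (S N)) -> x = p (fourier_stieltjes (mu t) xi) ->
    u N @[N --> \oo] --> x.
  move=> pn pB uE ->.
  rewrite (_ : u = (fun N => p (fourier_stieltjes (mu t) xi) -
      p (fourier_stieltjes (mu t) xi - S N))); last first.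
    by apply/funext => N; rewrite pB uE; ring.
  rewrite -[X in _ --> X]subr0; apply: cvgB; first exact: cvg_cst.
  apply/norm_cvg0P.
  apply: (squeeze_cvgr _ (cvg_cst 0) cz); near=> N.
  by rewrite normr_ge0/= (le_trans (pn _))// close.
have sumE (p : R[i] -> R) (x : nat -> R[i]) N :
   (forall a z, p ((a%:C)%C * z) = a * p z) ->
   (forall n (F : 'I_n -> R[i]), p (\sum_(j < n) F j) = \sum_(j < n) p (F j)) ->
   \sum_(0 <= n < N) (geometric_weight t n)%:num * p (x n) =
   p (wild_sum (expR (- t)) (1 - expR (- t)) x N).
  move=> pZ pS; rewrite big_mkord pS; apply: eq_bigr => n _.
  by rewrite pZ geometric_weightE.
have uE (p : R[i] -> R) (u : nat -> R) :
    (forall z, `|p z| <= normc z) -> (forall z z', p (z - z') = p z - p z') ->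
    (forall a z, p ((a%:C)%C * z) = a * p z) ->
    (forall n (F : 'I_n -> R[i]), p (\sum_(j < n) F j) = \sum_(j < n) p (F j)) ->
    (forall n, u n =
      p (Cintegral (k n) setT (fun v => Cexp (Complex 0 (xi * q v))))) ->
    \sum_(0 <= n < N) (geometric_weight t n)%:num * u n @[N --> \oo] -->
    p (fourier_stieltjes (mu t) xi).
  move=> pn pB pZ pS uE; apply: (cvgS p _ _ pn pB _ erefl) => N.
  rewrite -(sumE _ (fun n => r n xi) _ pZ pS).
  by apply: eq_bigr => n _; rewrite uE /r rE.
rewrite rE; apply: complexP.
  have H := @cvg_Rintegral_mixture _ _ _ _ k w1 _ bRe.
  have H2 := uE (@complex.Re R) _ (@normr_Re_le R) (fun z z' => etrans (ReD z _) (congr1 _ (ReN z')))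
    (@ReZ R) (@Re_sum R) (fun=> erefl).
  exact: (cvg_unique _ H H2).
have H := @cvg_Rintegral_mixture _ _ _ _ k w1 _ bIm.
have H2 := uE (@complex.Im R) _ (@normr_Im_le R) (fun z z' => etrans (ImD z _) (congr1 _ (ImN z')))
  (@ImZ R) (@Im_sum R) (fun=> erefl).
exact: (cvg_unique _ H H2).
Unshelve. all: by end_near.
Qed.

(** * The steady state is a fixed point of the collision operator *)

Lemma eq_measure_Cintegral d (T : measurableType d) (R : realType)
    (m1 m2 : probability T R) (f : T -> R[i]) :
  (forall A, measurable A -> m1 A = m2 A) ->
  Cintegral m1 setT f = Cintegral m2 setT f.
Proof.
move=> m12; apply: complexP => /=; congr fine;
  by apply: eq_measure_integral => A mA _; exact: m12.
Qed.

Lemma fourier_image_id (R : realType) (k : probability R R) :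
  fourier_stieltjes (image_probability k (@measurable_id _ R setT)) =1
  fourier_stieltjes k.
Proof.
move=> xi; rewrite /fourier_stieltjes Cintegral_image//.
by apply: Cbounded_measurable_cis; exact: mulrl_measurable.
Qed.

Section nonnegative_support.
Context (R : realType) (nu : probability R R).
Hypothesis nu0 : nu `]-oo, (0 : R)[%classic = 0%E.

Let negligible_neg (Q : R -> Prop) : (forall x, 0 <= x -> Q x) -> {ae nu, forall x, Q x}.
Proof.
move=> Q0; exists `]-oo, 0[%classic; split => // x /= nQ.
by rewrite in_itv/= ltNge; apply/negP => x0; exact: nQ (Q0 _ x0).
Qed.

Let bounded_abs (g : R -> R) : bounded_measurable g ->
  bounded_measurable (fun x : R => g `|x|).
Proof. by move=> bg; exact: (bounded_measurable_comp _ bg). Qed.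

(** The conditional transform of the steady state is bounded on the half-line
    carrying the mixing measure only; composing with the absolute value, which
    does not change the integrals, makes it bounded everywhere. *)
Lemma Rintegral_abs (g : R -> R) : bounded_measurable g ->
  \int[nu]_x g x = \int[nu]_x g `|x|.
Proof.
move=> bg; have [mg _] := bg; have [mga _] := bounded_abs bg.
congr fine; apply: ae_eq_integral => //; [exact/measurable_EFinP|exact/measurable_EFinP|].
by apply: negligible_neg => x x0 _; rewrite ger0_norm.
Qed.

Lemma Rintegral_nonneg (g : R -> R) : bounded_measurable (fun x : R => g `|x|) ->
  \int[nu]_(x in `[0, +oo[) g x = \int[nu]_x g `|x|.
Proof.
move=> [mga _].
transitivity (\int[nu]_(x in `[0, +oo[) g `|x|).
  by apply: eq_Rintegral => x; rewrite inE/= in_itv/= andbT => x0; rewrite ger0_norm.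
rewrite Rintegral_mkcond.
congr fine; apply: ae_eq_integral => //; [|exact/measurable_EFinP|].
  apply/measurable_EFinP.
  apply/(measurable_restrictT _ _).1 => //.
  exact: measurable_funTS.
apply: negligible_neg => x x0 _; rewrite patchE ifT//.
by rewrite inE/= in_itv/= x0.
Qed.

Lemma Cintegral_abs (g : R -> R[i]) : Cbounded_measurable g ->
  Cintegral nu setT g = Cintegral nu setT (fun x : R => g `|x|).
Proof.
by move=> [rg jg]; apply: complexP; rewrite /= [LHS]Rintegral_abs.
Qed.

Lemma Cintegral_nonneg (g : R -> R[i]) : Cbounded_measurable (fun x : R => g `|x|) ->
  Cintegral nu `[0, +oo[%classic g = Cintegral nu setT (fun x : R => g `|x|).
Proof.
by move=> [rg jg]; apply: complexP; rewrite /= [LHS]Rintegral_nonneg.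
Qed.

Lemma Cintegral_abs_prod (h : R * R -> R[i]) : Cbounded_measurable h ->
  Cintegral (independent_pair nu nu) setT h =
  Cintegral (independent_pair nu nu) setT (fun z => h (`|z.1|, `|z.2|)).
Proof.
move=> bh.
have mabs2 : measurable_fun setT (fun z : R * R => (`|z.1|, `|z.2|)).
  by apply/measurable_fun_pair; exact: measurableT_comp.
have mabs1 : measurable_fun setT (fun z : R * R => (z.1, `|z.2|)).
  by apply/measurable_fun_pair => //; exact: measurableT_comp.
have bh1 := Cbounded_measurable_comp mabs1 bh.
have bh2 := Cbounded_measurable_comp mabs2 bh.
rewrite [LHS](Cintegral_prod nu nu bh) [RHS](Cintegral_prod nu nu bh2).
transitivity (Cintegral nu setT (fun x => Cintegral nu setT (fun y => h (x, `|y|)))).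
  congr Cintegral; apply/funext => x.
  apply: (Cintegral_abs (g := fun y => h (x, y))).
  apply: (Cbounded_measurable_comp (h := fun y : R => (x, y)) _ bh).
  exact: measurable_pair1.
apply: (Cintegral_abs (g := fun x => Cintegral nu setT (fun y => h (x, `|y|)))).
exact: (Cbounded_measurable_Cintegral nu nu bh1).
Qed.

End nonnegative_support.

Section steady_state_theory.
Context d (T : measurableType d) (R : realType) (P : probability T R).
Variables (L M : {RV P >-> R}) (nu muoo : probability R R) (c0 gamma0 : R).
Hypotheses (L0 : forall w, 0 <= L w) (M0 : forall w, 0 <= M w) (c00 : 0 <= c0).
Hypothesis mixing : mixing_measure L M nu.
Hypothesis steady : steady_state nu c0 gamma0 muoo.

Let op1 (z : T * (R * R)) : R := L z.1 * z.2.1 + M z.1 * z.2.2.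

Let mop1 : measurable_fun setT op1.
Proof.
have m1 : measurable_fun setT (fun z : T * (R * R) => z.2.1).
  exact: measurableT_comp.
have m2 : measurable_fun setT (fun z : T * (R * R) => z.2.2).
  exact: measurableT_comp.
by apply: measurable_funD; apply: measurable_funM => //; exact: measurableT_comp.
Qed.

(** The equation between transforms becomes an equality of laws, against which
    functions other than the exponentials can be integrated. *)
Lemma mixing_collision A : measurable A -> collision P mop1 nu nu A = nu A.
Proof.
apply: fourier_stieltjes_inj => xi.
rewrite -fourier_image_id (fourier_collision P mop1 nu nu (L := L) (M := M))//.
have [_ _ ->] := mixing.
by congr Cintegral; apply/funext => w; rewrite !fourier_image_id.
Qed.

(** The conditional transform of the steady state given the mixing variable. *)
Definition mixed_transform (xi m : R) : R[i] :=
  Cexp (Complex (- (m * (c0 * pi * `|xi|))) (m * (gamma0 * xi))).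

Lemma Cbounded_mixed_transform xi :
  Cbounded_measurable (fun m : R => mixed_transform xi `|m|).
Proof.
apply: Cbounded_measurable_Cexp.
- apply: measurableT_comp => //; apply: measurable_funM => //.
- by apply: measurable_funM => //.
- by move=> x; rewrite oppr_le0 !mulr_ge0// pi_ge0.
Qed.

Lemma steady_transform xi : fourier_stieltjes muoo xi =
  Cintegral nu setT (fun m : R => mixed_transform xi `|m|).
Proof.
have [nu0 _ _] := mixing.
rewrite steady -(Cintegral_nonneg nu0 (g := mixed_transform xi))//.
exact: Cbounded_mixed_transform.
Qed.

(** The conditional transform is an exponential in the mixing variable whose
    exponent is positively homogeneous in [xi]; evaluated at
    [L w * x + M w * y] it is the product of the values at [x] and [y] for the
    frequencies [L w * xi] and [M w * xi]. *)
Lemma steady_collision xi : fourier_stieltjes muoo xi =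
  Cexpectation P (fun w => fourier_stieltjes muoo (L w * xi) *
                           fourier_stieltjes muoo (M w * xi)).
Proof.
have [nu0 _ _] := mixing.
have bG := Cbounded_mixed_transform.
rewrite steady_transform -(eq_measure_Cintegral _ mixing_collision).
rewrite Cintegral_collision//; congr Cintegral; apply/funext => w.
rewrite Cintegral_abs_prod//; last first.
  apply: (Cbounded_measurable_comp _ (bG xi)).
  by apply: (measurableT_comp mop1); exact: measurable_pair1.
rewrite !steady_transform -(Cintegral_prod_mul nu nu (bG _) (bG _)).
congr Cintegral; apply/funext => -[x y] /=.
rewrite /op1/= ger0_norm ?addr_ge0 ?mulr_ge0// /mixed_transform -CexpD.
by congr Cexp; apply: complexP; rewrite ?ReD ?ImD/= ?normrM ?(ger0_norm (L0 w))
  ?(ger0_norm (M0 w)); ring.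
Qed.

End steady_state_theory.

(** * The coupling differences are centred *)

Section sine_estimates.
Context (R : realType).

Lemma MVT_norm_le (f f' : R -> R) (C x y : R) :
  (forall z, is_derive z (1 : R) f (f' z)) ->
  (forall z, `|z - x| <= `|y - x| -> `|f' z| <= C) ->
  `|f y - f x| <= C * `|y - x|.
Proof.
move=> df f'C.
have cf z : {for z, continuous f}.
  by apply/differentiable_continuous/derivable1_diffP; case: (df z).
have [xy|yx] := leP x y.
  have [c cxy ->] := @MVT_segment _ f f' x y xy (fun z _ => df z)
    (continuous_subspaceT cf).
  rewrite normrM ler_wpM2r// f'C//.
  by move: cxy; rewrite in_itv/= => /andP[xc cy]; rewrite !ger0_norm; lra.
have [c cxy E] := @MVT_segment _ f f' y x (ltW yx) (fun z _ => df z)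
    (continuous_subspaceT cf).
rewrite distrC E normrM [`|x - y|]distrC ler_wpM2r// f'C//.
by move: cxy; rewrite in_itv/= => /andP[yc cx]; rewrite !ler0_norm; lra.
Qed.

Lemma sin_lipschitz (x y : R) : `|sin y - sin x| <= `|y - x|.
Proof.
rewrite -[leRHS]mul1r; apply: (@MVT_norm_le _ cos).
by move=> z _; rewrite ler_norml cos_geN1 cos_le1.
Qed.

Lemma cos_sub1_le (x : R) : `|cos x - 1| <= `|x|.
Proof.
rewrite -cos0 -[x in leRHS]subr0 -[leRHS]mul1r.
apply: (@MVT_norm_le _ (fun z => - sin z)).
by move=> z _; rewrite normrN ler_norml sin_geN1 sin_le1.
Qed.

Lemma sin_sub_le (x : R) : `|sin x - x| <= x ^+ 2.
Proof.
have dh (z : R) : is_derive z (1 : R) (fun x => sin x - x) (cos z - 1).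
  exact: is_derive_eq.
have := @MVT_norm_le _ _ `|x| 0 x dh.
rewrite sin0 !subr0 -expr2 real_normK ?num_real//; apply => z.
by rewrite !subr0 => /(le_trans (cos_sub1_le z)).
Qed.

Lemma cvg_sin_ratio (a : R) (x : nat -> R) :
  (forall n, 0 < x n) -> x n @[n --> \oo] --> (0 : R) ->
  sin (x n * a) / x n @[n --> \oo] --> a.
Proof.
move=> x0 cx; apply/(@cvgrPdist_le _ R^o) => e e0.
have cx2 : x n * a ^+ 2 @[n --> \oo] --> (0 : R).
  by rewrite -[X in _ --> X](mul0r (a ^+ 2)); apply: cvgM => //; exact: cvg_cst.
have /(@cvgrPdist_le _ R^o) /(_ e e0) := cx2.
apply: filterS => n; rewrite sub0r normrN ger0_norm; last first.
  by rewrite mulr_ge0 ?sqr_ge0// ltW.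
apply: le_trans.
have -> : a - sin (x n * a) / x n = - (sin (x n * a) - x n * a) / x n.
  by field; rewrite gt_eqF.
rewrite normrM normrN normfV (gtr0_norm (x0 n)) ler_pdivrMr//.
by rewrite (le_trans (sin_sub_le _))// exprMn expr2 mulrAC.
Qed.

End sine_estimates.

Section steady_sine_mean.
Context d (T : measurableType d) (R : realType) (P : probability T R).
Variables (L M : {RV P >-> R}) (nu muoo : probability R R) (c0 gamma0 : R).
Hypothesis c00 : 0 <= c0.
Hypothesis mixing : mixing_measure L M nu.
Hypothesis steady : steady_state nu c0 gamma0 muoo.

Lemma integral_abs_mixing : (\int[nu]_m (`|m|)%:E = 1)%E.
Proof.
have [nu0 <- _] := mixing.
have mN : measurable_fun setT (fun m : R => (`|m|)%:E).
  by apply/measurable_EFinP; exact: normr_measurable.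
rewrite -(setUv `[(0 : R), +oo[%classic) ge0_integral_setU//=; last 3 first.
- exact: measurableC.
- by rewrite setUv.
- by apply/disj_setPCl.
rewrite setCitvr [X in (_ + X)%E](_ : _ = 0%E) ?adde0.
  by apply: eq_integral => m; rewrite inE/= in_itv/= andbT => m0; rewrite ger0_norm.
apply: null_set_integral => //.
by apply: measurable_funTS.
Qed.

(** Given the mixing variable [m] the steady state is a Cauchy law centred at
    [m * gamma0], whose sine means are explicit; divided by the frequency
    they are at most [`|gamma0| * m], and the mixing measure has mean one. *)
Lemma steady_sine_mean (x : nat -> R) :
  (forall n, 0 < x n) -> x n @[n --> \oo] --> (0 : R) ->
  (\int[muoo]_v sin (x n * v)) / x n @[n --> \oo] --> gamma0.
Proof.
move=> x0 cx.
pose f n (m : R) := expR (- (`|m| * (c0 * pi * `|x n|))) *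
  (sin (x n * (`|m| * gamma0)) / x n).
have sinE n : (\int[muoo]_v sin (x n * v)) / x n = \int[nu]_m f n m.
  rewrite -Im_fourier_stieltjes (steady_transform c00 mixing steady)/=.
  have [_ bI] := Cbounded_mixed_transform gamma0 c00 (x n).
  rewrite mulrC -RintegralZl//; last exact: bounded_measurable_integrable bI.
  apply: eq_Rintegral => m _; rewrite /f /mixed_transform/=.
  rewrite (_ : x n * (`|m| * gamma0) = `|m| * (gamma0 * x n)); last by ring.
  by ring.
under eq_fun do rewrite sinE.
have nint : nu.-integrable setT (fun m : R => (`|gamma0| * `|m|)%:E).
  under eq_fun do rewrite EFinM.
  apply: integrableZl => //; apply/integrableP; split.
    by apply/measurable_EFinP; exact: normr_measurable.
  by under eq_integral do rewrite /= normr_id; rewrite integral_abs_mixing ltry.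
have mf n : measurable_fun setT (fun m => (f n m)%:E).
  apply/measurable_EFinP; apply: measurable_funM.
    apply: (measurableT_comp (@measurable_expR R)).
    by apply: measurableT_comp => //; apply: measurable_funM.
  apply: measurable_funM => //.
  apply: (measurableT_comp (@measurable_sin R)).
  by apply: measurable_funM => //; apply: measurable_funM.
have mg : measurable_fun setT (fun m : R => (`|m| * gamma0)%:E).
  by apply/measurable_EFinP; apply: measurable_funM.
have fg : {ae nu, forall m, setT m -> (f n m)%:E @[n --> \oo] --> (`|m| * gamma0)%:E}.
  apply: aeW => m _; apply: cvg_EFin; first by near=> n.
  rewrite -[X in _ --> X]mul1r; apply: cvgM; last exact: cvg_sin_ratio.
  have N0 : - (`|m| * (c0 * pi * `|x n|)) @[n --> \oo] --> (0 : R).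
    rewrite -[X in _ --> X]oppr0; apply: cvgN.
    rewrite -[X in _ --> X](mulr0 `|m|); apply: cvgM; first exact: cvg_cst.
    rewrite -[X in _ --> X](mulr0 (c0 * pi)); apply: cvgM; first exact: cvg_cst.
    by rewrite -[X in _ --> X](@normr0 R R); apply: cvg_norm.
  have := cvg_comp _ _ N0 (@continuous_expR R 0).
  by rewrite expR0.
have fb : {ae nu, forall m n, setT m -> (`|(f n m)%:E| <= (`|gamma0| * `|m|)%:E)%E}.
  apply: aeW => m n _; rewrite /= lee_fin normrM -[leRHS]mul1r.
  apply: ler_pM => //.
    by rewrite ger0_norm ?expR_ge0// -expR0 ler_expR oppr_le0 !mulr_ge0 ?pi_ge0.
  rewrite normrM normfV (gtr0_norm (x0 n)) ler_pdivrMr//.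
  have := sin_lipschitz 0 (x n * (`|m| * gamma0)).
  rewrite sin0 !subr0 => /le_trans; apply.
  by rewrite !normrM normr_id (gtr0_norm (x0 n)) mulrC [_ * `|gamma0|]mulrC.
have [ig _ H] := dominated_convergence measurableT mf mg fg nint fb.
have -> : gamma0 = \int[nu]_m (`|m| * gamma0).
  rewrite RintegralZr//.
    by rewrite /Rintegral integral_abs_mixing mul1r.
  apply/integrableP; split.
    by apply/measurable_EFinP; exact: normr_measurable.
  by under eq_integral do rewrite /= normr_id; rewrite integral_abs_mixing ltry.
by apply: fine_cvg; rewrite fineK//; exact: integrable_fin_num ig.
Unshelve. all: by end_near.
Qed.

End steady_sine_mean.

Section truncated_sine_mean.
Context (R : realType) (mu : probability R R).

Local Notation F := (distribution_function mu).

(** The difference of the two tails at distance [y]; it is what remains of the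
    layer-cake formula for an odd function. *)
Definition tail_difference (y : R) : R := (1 - F y) - F (- y).

Lemma distribution_functionE (y : R) : F y = \int[mu]_x \1_(`]-oo, y]%classic) x.
Proof. by rewrite /Rintegral integral_indic// setIT. Qed.

Lemma bounded_measurable_indic d (T : measurableType d) (A : set T) :
  measurable A -> bounded_measurable (\1_A : T -> R).
Proof.
move=> mA; split; first exact: measurable_indic.
by exists 1 => x; rewrite indicE normr_nat lern1 leq_b1.
Qed.

Lemma right_tailE (y : R) : 1 - F y = \int[mu]_x \1_(`]y, +oo[%classic) x.
Proof.
have -> : 1 = \int[mu]_x (1 : R).
  rewrite Rintegral_cst// [X in fine X](_ : _ = 1%E) ?mulr1//.
  exact: probability_setT.
rewrite distribution_functionE -RintegralB//; last 2 first.
- exact: bounded_measurable_integrable (bounded_measurable_cst 1).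
- apply: bounded_measurable_integrable; exact: bounded_measurable_indic.
apply: eq_Rintegral => x _; rewrite !indicE !mem_setE !in_itv/= andbT ltNge.
by case: (x <= y); rewrite ?subrr ?subr0.
Qed.

Lemma distribution_function01 (y : R) : 0 <= F y <= 1.
Proof.
rewrite fine_ge0//= -lee_fin fineK ?fin_num_measure//.
exact: probability_le1.
Qed.

Lemma tail_difference_le1 (y : R) : `|tail_difference y| <= 1.
Proof.
rewrite /tail_difference.
have /andP[a0 a1] := distribution_function01 y.
have /andP[b0 b1] := distribution_function01 (- y).
by rewrite ler_norml; lra.
Qed.

Let tail_kernel (y x : R) : R := \1_(`]y, +oo[%classic) x - \1_(`]-oo, - y]%classic) x.

Let bounded_tail_kernel :
  bounded_measurable (fun z : R * R => tail_kernel z.2 z.1).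
Proof.
have E1 : (fun z : R * R => \1_(`]z.2, +oo[%classic) z.1) =
    (fun z => if z.2 < z.1 then 1 else 0 : R).
  apply/funext => z; rewrite indicE mem_setE in_itv/= andbT.
  by case: ifP.
have E2 : (fun z : R * R => \1_(`]-oo, - z.2]%classic) z.1) =
    (fun z => if - z.2 < z.1 then 0 else 1 : R).
  apply/funext => z; rewrite indicE mem_setE in_itv/= ltNge.
  by case: (_ <= _).
have b01 (b : bool) (c1 c2 : R) : 0 <= c1 <= 1 -> 0 <= c2 <= 1 ->
  `|if b then c1 else c2| <= 1 by case: b => /andP[? ?] /andP[? ?]; rewrite ger0_norm.
apply: bounded_measurableB.
  rewrite E1; split.
    by apply: measurable_fun_ifT => //; exact: measurable_fun_ltr.
  by exists 1 => z; apply: b01; rewrite ?lexx ?ler01.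
rewrite E2; split.
  apply: measurable_fun_ifT => //; apply: measurable_fun_ltr => //.
  exact: measurableT_comp.
by exists 1 => z; apply: b01; rewrite ?lexx ?ler01.
Qed.

Lemma tail_differenceE (y : R) : tail_difference y = \int[mu]_x tail_kernel y x.
Proof.
rewrite /tail_difference right_tailE distribution_functionE RintegralB//;
  by apply: bounded_measurable_integrable; exact: bounded_measurable_indic.
Qed.

Lemma bounded_measurable_tail_difference : bounded_measurable tail_difference.
Proof.
rewrite (funext tail_differenceE).
apply: (bounded_measurable_Rintegral1 mu mu
  (f := fun z : R * R => tail_kernel z.1 z.2)).
exact: (bounded_measurable_swap bounded_tail_kernel).
Qed.

Definition clip0 (B a : R) : R := Num.max 0 (Num.min a B).

Variables (xi B : R).
Hypotheses (xi0 : 0 < xi) (B0 : 0 < B).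

Let k (y : R) : R := cos (xi * y) - 1.
Let K (y : R) : R := sin (xi * y) / xi - y.

Let ck : continuous k.
Proof.
by move=> y; apply/differentiable_continuous/derivable1_diffP; exact: ex_derive.
Qed.

Let dK (y : R) : is_derive y (1 : R) K (k y).
Proof.
apply: is_derive_eq; rewrite /GRing.scale/= /k.
by field; rewrite gt_eqF.
Qed.

Let bk : bounded_measurable k.
Proof.
apply: bounded_measurableB; last exact: bounded_measurable_cst.
by apply: bounded_measurable_cos; exact: mulrl_measurable.
Qed.

Let K0 : K 0 = 0. Proof. by rewrite /K mulr0 sin0 mul0r subrr. Qed.

Let ik (a b : R) : lebesgue_measure.-integrable `[a, b] (EFin \o k).
Proof.
apply: continuous_compact_integrable; first exact: segment_compact.
exact: continuous_subspaceT.
Qed.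

Let integral_below (a : R) (b : bool) :
  \int[lebesgue_measure]_(y in `[0, B] `&` [set` Interval -oo%O (BSide b a)]) k y =
  K (clip0 B a).
Proof.
rewrite /clip0; have [a0|a0] := leP a 0.
  have -> : Num.max 0 (Num.min a B) = 0.
    by rewrite max_l// ge_min a0.
  rewrite K0.
  move: a0; rewrite le_eqVlt => /predU1P[->|a0].
    case: b.
      rewrite (_ : _ `&` _ = set0) ?Rintegral_set0//.
      by apply/seteqP; split => // y /=; rewrite !in_itv/=; lra.
    rewrite (_ : _ `&` _ = [set 0]) ?Rintegral_set1//.
    by apply/seteqP; split => // y /=; rewrite !in_itv/=; [lra|move=> ->; rewrite lexx ltW].
  rewrite (_ : _ `&` _ = set0) ?Rintegral_set0//.
  by apply/seteqP; split => // y /=; rewrite !in_itv/=; case: b; rewrite /=; lra.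
set m := Num.max 0 (Num.min a B).
have mE : m = Num.min a B by rewrite /m max_r// le_min !ltW.
have m0 : 0 < m by rewrite mE lt_min a0.
have Kint : \int[lebesgue_measure]_(y in `[0, m]) k y = K m.
  by rewrite (Rintegral_derivative (ltW m0) ck dK) K0 subr0.
have Kint' : \int[lebesgue_measure]_(y in `[0, m[) k y = K m.
  rewrite Rintegral_itv_bndo_bndc//.
  by apply: integrableS (ik 0 m) => //; exact: subset_itv_co_cc.
have SE : `[0, B] `&` [set` Interval -oo%O (BSide b a)] = `[0, m[%classic \/
          `[0, B] `&` [set` Interval -oo%O (BSide b a)] = `[0, m]%classic.
  rewrite mE; case: leP => aB.
    by case: (b); [left|right]; apply/seteqP; split => y /=; rewrite !in_itv/=; lra.
  by right; apply/seteqP; split => y /=; rewrite !in_itv/=; case: (b) => /=; lra.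
by case: SE => ->.
Qed.

(** Layer cake: [K] is the primitive of [k] vanishing at 0, and the two tails
    contribute its values at the positive and negative parts of the truncated
    variable. *)
Lemma tail_integral :
  \int[lebesgue_measure]_(y in `[0, B]) (k y * tail_difference y) =
  \int[mu]_x (K (clip0 B x) - K (clip0 B (- x))).
Proof.
have bf : bounded_measurable (fun z : R * R => k z.2 * tail_kernel z.2 z.1).
  apply: bounded_measurableM => //.
  exact: (bounded_measurable_comp _ bk).
transitivity (\int[lebesgue_measure]_(y in `[0, B]) \int[mu]_x (k y * tail_kernel y x)).
  apply: eq_Rintegral => y _; rewrite tail_differenceE RintegralZl//.
  apply: bounded_measurable_integrable.
  by apply: bounded_measurableB; exact: bounded_measurable_indic.
rewrite -(Rintegral_fubini_itv mu 0 B bf); apply: eq_Rintegral => x _ /=.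
have restrE (A : set R) : measurable A ->
    \int[lebesgue_measure]_(y in `[0, B] `&` A) k y =
    \int[lebesgue_measure]_(y in `[0, B]) (k y * \1_A y).
  move=> mA; rewrite Rintegral_mkcondr; apply: eq_Rintegral => y _.
  by rewrite patchE indicE; case: ifP; rewrite ?mulr1 ?mulr0.
have iA (A : set R) : measurable A ->
    lebesgue_measure.-integrable `[0, B] (EFin \o (fun y => k y * \1_A y)).
  move=> mA; apply: (le_integrable _ _ _ (ik 0 B)) => //.
    apply/measurable_EFinP; apply: measurable_funTS.
    by case: (bounded_measurableM bk (bounded_measurable_indic mA)).
  move=> y _ /=; rewrite lee_fin normrM ler_piMr//.
  by rewrite indicE normr_nat lern1 leq_b1.
rewrite -(integral_below x true) -(integral_below (- x) false).
rewrite !restrE// -RintegralB//; [|exact: iA|exact: iA].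
apply: eq_Rintegral => y _; rewrite /tail_kernel mulrBr.
congr (_ * _ - _ * _).
  by rewrite !indicE !mem_setE !in_itv/= andbT.
by rewrite !indicE !mem_setE !in_itv/= lerNr.
Qed.

Definition clip (x : R) : R := clip0 B x - clip0 B (- x).

Lemma clip0E (a : R) :
  clip0 B a = if a <= 0 then 0 else if a < B then a else B.
Proof.
rewrite /clip0; have [a0|a0] := leP a 0.
  by rewrite max_l// ge_min a0.
rewrite max_r; last by rewrite le_min !ltW.
by case: ltP.
Qed.

Lemma clipE (x : R) : clip x = if x <= - B then - B else if x < B then x else B.
Proof.
rewrite /clip !clip0E oppr_le0 ltrNl.
have [x0|x0] := leP x 0.
  rewrite sub0r; have [x0'|x0'] := leP 0 x.
    have -> : x = 0 by lra.
    by rewrite oppr_ge0 leNgt B0/= oppr0.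
  by have [xB|xB] := ltP (- B) x; rewrite ?opprK// (lt_le_trans x0' (ltW B0)).
by rewrite (ltW x0) subr0 [RHS]ifN// -ltNge (lt_trans _ x0)// oppr_lt0.
Qed.

Let K_clip (x : R) : K (clip0 B x) - K (clip0 B (- x)) = sin (xi * clip x) / xi - clip x.
Proof.
have E : clip0 B x = 0 \/ clip0 B (- x) = 0.
  rewrite /clip0; case: (leP x 0) => h0; [left|right].
    by rewrite max_l ?ge_min ?h0.
  by rewrite max_l// ge_min; apply/orP; left; lra.
rewrite /clip; case: E => ->; rewrite ?K0 ?sub0r ?subr0 /K//.
by rewrite mulrN sinN mulNr; ring.
Qed.

Lemma bounded_clip : bounded_measurable clip.
Proof.
split.
  rewrite (funext clipE); apply: measurable_fun_ifT => //.
    exact: measurable_fun_ler.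
  by apply: measurable_fun_ifT => //; exact: measurable_fun_ltr.
exists B => x; rewrite clipE; have B0' := B0.
by case: (leP x (- B)) => h1; last case: (ltP x B) => h2;
  rewrite ler_norml; lra.
Qed.

(** Truncating the variable at level [B] changes its sine by at most 2 and only
    outside of [`]- B, B[]; the truncated variable is left to
    [tail_integral]. *)
Lemma sine_mean_estimate :
  `|\int[mu]_x (sin (xi * x)) / xi - \int[mu]_x clip x| <=
  `|\int[lebesgue_measure]_(y in `[0, B]) (k y * tail_difference y)| +
  2 * ((1 - F B) + F (- B)) / xi.
Proof.
have bs : bounded_measurable (fun x => sin (xi * x)).
  by apply: bounded_measurable_sin; exact: mulrl_measurable.
have bsc : bounded_measurable (fun x => sin (xi * clip x)).
  apply: bounded_measurable_sin; apply: measurable_funM => //.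
  by case: bounded_clip.
have biv (f : R -> R) : bounded_measurable f -> bounded_measurable (fun x => f x / xi).
  by move=> bf; apply: bounded_measurableM => //; exact: bounded_measurable_cst.
have int (f : R -> R) : bounded_measurable f -> mu.-integrable setT (EFin \o f).
  exact: bounded_measurable_integrable.
have -> : \int[mu]_x (sin (xi * x)) / xi - \int[mu]_x clip x =
    \int[lebesgue_measure]_(y in `[0, B]) (k y * tail_difference y) +
    (\int[mu]_x (sin (xi * x) - sin (xi * clip x))) / xi.
  rewrite tail_integral; under [X in _ = X + _]eq_Rintegral do rewrite K_clip.
  rewrite RintegralB//; [|exact: int _ bs|exact: int _ bsc].
  rewrite [X in _ = X + _]RintegralB//; [|exact: int _ (biv _ bsc)|exact: int _ bounded_clip].
  rewrite RintegralZr//; last exact: int _ bsc.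
  by ring.
rewrite (le_trans (ler_normD _ _))// lerD2l normrM normfV (gtr0_norm xi0).
rewrite ler_wpM2r ?invr_ge0 ?(ltW xi0)//.
have bd : bounded_measurable (fun x => sin (xi * x) - sin (xi * clip x)).
  exact: bounded_measurableB.
apply: (le_trans (le_normr_Rintegral measurableT (int _ bd))).
have b1 := bounded_measurable_indic (measurable_itv (`]B, +oo[ : interval R)).
have b2 := bounded_measurable_indic (measurable_itv (`]-oo, - B] : interval R)).
rewrite right_tailE distribution_functionE -RintegralD//; [|exact: int _ b1|exact: int _ b2].
rewrite -RintegralZl//; last exact: int _ (bounded_measurableD b1 b2).
apply: le_Rintegral => //.
- by apply: integrable_norm; exact: int _ bd.
- exact: int _ (bounded_measurableM (bounded_measurable_cst 2) (bounded_measurableD b1 b2)).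
move=> x _; rewrite !indicE !mem_setE !in_itv/= andbT clipE.
have sin1 (y : R) : `|sin y| <= 1 by rewrite ler_norml sin_geN1 sin_le1.
have two (a b : R) : `|sin a - sin b| <= 2.
  by rewrite (le_trans (ler_normB _ _))// -[2]/(1 + 1) lerD.
case: (leP x (- B)) => h1.
  by rewrite (le_trans (two _ _))//; case: (B < x); rewrite /= ?addr0 ?add0r; lra.
case: (ltP x B) => h2.
  by rewrite subrr normr0 mulr_ge0// addr_ge0.
move: h2; rewrite le_eqVlt => /predU1P[->|h2].
  by rewrite subrr normr0 mulr_ge0// addr_ge0.
by rewrite h2 (le_trans (two _ _))//= addr0 mulr1.
Qed.

End truncated_sine_mean.

Section sine_mean_limit.
Context (R : realType) (mu : probability R R) (c0 gamma0 : R).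

Local Notation F := (distribution_function mu).

Hypothesis left_tail : `|x| * F x @[x --> -oo] --> c0.
Hypothesis right_tail : x * (1 - F x) @[x --> +oo] --> c0.
Hypothesis truncated_mean :
  \int[mu]_(x in `]- rho, rho[) x @[rho --> +oo] --> gamma0.

Let left_tail' : y * F (- y) @[y --> +oo] --> c0.
Proof.
have /cvgNy_compNP H := left_tail.
apply: cvg_trans H; apply: near_eq_cvg; near=> y.
by rewrite /= normrN ger0_norm//; near: y; exact: nbhs_pinfty_ge.
Unshelve. all: by end_near.
Qed.

Let B (n : nat) : R := n.+2%:R.

Let le_B n : n%:R <= B n. Proof. by rewrite ler_nat (leqW (leqnSn n)). Qed.

Let B_gt0 n : 0 < B n. Proof. by rewrite /B ltr0n. Qed.

Let cvg_S : n.+1%:R @[n --> \oo] --> (+oo : set_system R).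
Proof.
apply: (@ger_cvgy _ _ _ _ (fun n => n%:R : R)); last exact: cvgr_idn.
by near=> n; rewrite ler_nat.
Unshelve. all: by end_near.
Qed.

Let cvg_B : B n @[n --> \oo] --> +oo.
Proof.
apply: (@ger_cvgy _ _ _ _ (fun n => n%:R : R)); last exact: cvgr_idn.
by near=> n; exact: le_B.
Unshelve. all: by end_near.
Qed.

Let cvg_right : B n * (1 - F (B n)) @[n --> \oo] --> c0.
Proof. by have /cvg_pinftyP := right_tail; apply. Qed.

Let cvg_left : B n * F (- B n) @[n --> \oo] --> c0.
Proof. by have /cvg_pinftyP := left_tail'; apply. Qed.

Let cvg_tail_difference : y * tail_difference mu y @[y --> +oo] --> (0 : R).
Proof.
rewrite -(subrr c0) /tail_difference; under eq_fun do rewrite mulrBr.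
exact: cvgB right_tail left_tail'.
Qed.

(** An atom at the end point [B n] is absorbed by the tail beyond [B n - 1]. *)
Let cvg_closed_right : B n * fine (mu `[B n, +oo[%classic) @[n --> \oo] --> c0.
Proof.
have tail0 : 1 - F n.+1%:R @[n --> \oo] --> (0 : R).
  rewrite -(mulr0 c0).
  have H : n.+1%:R * (1 - F n.+1%:R) @[n --> \oo] --> c0.
    by have /cvg_pinftyP := right_tail; apply.
  rewrite (_ : (fun n => _) =
      (fun n => n.+1%:R * (1 - F n.+1%:R) * harmonic n)); last first.
    by apply/funext => n; rewrite /harmonic/= mulrAC divff ?mul1r.
  exact: cvgM H (@cvg_harmonic R).
have upper : B n * (1 - F n.+1%:R) @[n --> \oo] --> c0.
  rewrite -[X in _ --> X]addr0.
  have H : n.+1%:R * (1 - F n.+1%:R) @[n --> \oo] --> c0.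
    by have /cvg_pinftyP := right_tail; apply.
  rewrite (_ : (fun n => _) =
      (fun n => n.+1%:R * (1 - F n.+1%:R) + (1 - F n.+1%:R))); last first.
    by apply/funext => n; rewrite /B -[in LHS]natr1 mulrDl mul1r.
  exact: cvgD H tail0.
apply: (squeeze_cvgr _ cvg_right upper); near=> n.
have fE (A : set R) : measurable A -> fine (mu A) = \int[mu]_x \1_A x.
  by move=> mA; rewrite /Rintegral integral_indic// setIT.
have i1 (A : set R) : measurable A -> mu.-integrable setT (EFin \o \1_A).
  by move=> mA; apply: bounded_measurable_integrable; exact: bounded_measurable_indic.
rewrite !right_tailE fE// !ler_pM2l//; apply/andP; split;
    apply: le_Rintegral => //; try exact: i1; move=> x _;
    rewrite !indicE !mem_setE !in_itv/= !andbT ler_nat.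
  by case: (ltP (B n) x) => // Bx; rewrite (ltW Bx).
case: (leP (B n) x) => // Bx; rewrite (lt_le_trans _ Bx)//.
by rewrite ltr_nat.
Unshelve. all: by end_near.
Qed.

(** The open truncation in the hypothesis differs from [clip] by the mass [B n]
    times the two tails, and these cancel in the limit. *)
Let cvg_clip : \int[mu]_x clip (B n) x @[n --> \oo] --> gamma0.
Proof.
have HT : \int[mu]_(x in `]- B n, B n[) x @[n --> \oo] --> gamma0.
  by have /cvg_pinftyP := truncated_mean; apply.
suff clipS n : \int[mu]_x clip (B n) x = \int[mu]_(x in `]- B n, B n[) x +
    B n * fine (mu `[B n, +oo[%classic) - B n * F (- B n).
  rewrite (funext clipS) -[gamma0](addrK c0).
  exact: cvgB (cvgD HT cvg_closed_right) cvg_left.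
have b1 : bounded_measurable (fun x : R => x * \1_(`]- B n, B n[%classic) x).
  split; first by apply: measurable_funM => //; exact: measurable_indic.
  exists (B n) => x; rewrite indicE mem_setE in_itv/=.
  case: (boolP (_ && _)) => [/andP[h1 h2]|_]; last by rewrite mulr0 normr0 ltW.
  by rewrite mulr1 ler_norml !ltW.
have b2 : bounded_measurable (fun x : R => B n * \1_(`[B n, +oo[%classic) x).
  by apply: bounded_measurableM; [exact: bounded_measurable_cst|
    exact: bounded_measurable_indic].
have b3 : bounded_measurable (fun x : R => B n * \1_(`]-oo, - B n]%classic) x).
  by apply: bounded_measurableM; [exact: bounded_measurable_cst|
    exact: bounded_measurable_indic].
have int (f : R -> R) : bounded_measurable f -> mu.-integrable setT (EFin \o f).
  exact: bounded_measurable_integrable.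
have indi (A : set R) : measurable A -> mu.-integrable setT (EFin \o \1_A).
  by move=> mA; apply: int; exact: bounded_measurable_indic.
transitivity (\int[mu]_x (x * \1_(`]- B n, B n[%classic) x +
    B n * \1_(`[B n, +oo[%classic) x - B n * \1_(`]-oo, - B n]%classic) x)).
  apply: eq_Rintegral => x _; rewrite clipE// !indicE !mem_setE !in_itv/= andbT.
  have Bn := B_gt0 n.
  case: (leP x (- B n)) => h1.
    rewrite mulr0 mulr1 add0r [(B n <= x)]leNgt.
    by rewrite (le_lt_trans h1)/= ?mulr0 ?sub0r//; lra.
  by rewrite mulr0 subr0/=; case: (ltP x (B n)) => h2;
    rewrite ?mulr1 ?mulr0 ?addr0 ?add0r.
rewrite RintegralB//; [|exact: int _ (bounded_measurableD b1 b2)|exact: int _ b3].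
rewrite RintegralD//; [|exact: int _ b1|exact: int _ b2].
rewrite !RintegralZl//; [|exact: indi|exact: indi].
rewrite distribution_functionE; congr (_ + _ * _ - _).
  rewrite [RHS]Rintegral_mkcond; apply: eq_Rintegral => x _.
  by rewrite patchE indicE; case: ifP; rewrite ?mulr1 ?mulr0.
by rewrite /Rintegral integral_indic// setIT.
Qed.

Let xi K n : R := K / B n.

(** Since [`|cos z - 1| <= `|z|], the integrand is at most [xi K n] times
    [`|y * tail_difference mu y|], which vanishes at infinity; the interval has
    length [K / xi K n]. *)
Let cvg_kernel (K : R) : 0 < K ->
  \int[lebesgue_measure]_(y in `[0, B n])
    ((cos (xi K n * y) - 1) * tail_difference mu y) @[n --> \oo] --> (0 : R).
Proof.
move=> K0; apply/(@cvgrPdist_le _ R^o) => e e0.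
have e'0 : 0 < e / (2 * K) by rewrite divr_gt0 ?mulr_gt0.
have /(@cvgrPdist_le _ R^o) /(_ _ e'0) [Y [_ HY]] := cvg_tail_difference.
pose Z := Num.max Y 1.
have Z0 : 0 < Z by rewrite /Z lt_max ltr01 orbT.
have HZ y : Z < y -> `|y * tail_difference mu y| <= e / (2 * K).
  move=> Zy; have := HY y; rewrite sub0r normrN; apply.
  by rewrite (le_lt_trans _ Zy)// /Z le_max lexx.
near=> n; rewrite sub0r normrN.
have x0 : 0 < xi K n by rewrite divr_gt0.
have bound y : 0 <= y ->
    `|(cos (xi K n * y) - 1) * tail_difference mu y| <=
    xi K n * (e / (2 * K)) + xi K n * Z * \1_(`[0, Z]%classic) y.
  move=> y0; rewrite normrM.
  apply: (@le_trans _ _ (xi K n * (y * `|tail_difference mu y|))).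
    rewrite mulrA ler_wpM2r// (le_trans (cos_sub1_le _))//.
    by rewrite normrM !ger0_norm// ltW.
  rewrite -mulrA -mulrDr ler_wpM2l ?(ltW x0)//.
  rewrite indicE mem_setE in_itv/= y0/=; case: (leP y Z) => yZ /=.
    rewrite mulr1 (@le_trans _ _ Z)//; last by rewrite lerDr ltW.
    rewrite -[leRHS]mulr1 ler_pM// tail_difference_le1//.
  by rewrite mulr0 addr0 -[X in X * _](ger0_norm y0) -normrM HZ.
have BZ : Z <= B n.
  apply: le_trans (le_B n).
  by near: n; exact: nbhs_infty_ger.
have ifin (f : R -> R) : bounded_measurable f ->
    lebesgue_measure.-integrable `[0, B n] (EFin \o f).
  move=> [mf [C fC]]; apply: measurable_bounded_integrable => //.
  - by rewrite /= lebesgue_measure_itv/= lte_fin B_gt0 ltry.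
  - exact: measurable_funTS.
  - by exists C; split; [exact: num_real|move=> A CA y _; exact: le_trans (fC y) (ltW CA)].
have bkD : bounded_measurable
    (fun y => (cos (xi K n * y) - 1) * tail_difference mu y).
  apply: bounded_measurableM; last exact: bounded_measurable_tail_difference.
  apply: bounded_measurableB; last exact: bounded_measurable_cst.
  by apply: bounded_measurable_cos; exact: mulrl_measurable.
have b1 := bounded_measurable_cst (T := R) (xi K n * (e / (2 * K))).
have b2 : bounded_measurable (fun y : R => xi K n * Z * \1_(`[0, Z]%classic) y).
  by apply: bounded_measurableM; [exact: bounded_measurable_cst|
    exact: bounded_measurable_indic].
apply: (le_trans (le_normr_Rintegral _ (ifin _ bkD))); first exact: measurable_itv.
apply: (@le_trans _ _ (\int[lebesgue_measure]_(y in `[0, B n])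
  (xi K n * (e / (2 * K)) + xi K n * Z * \1_(`[0, Z]%classic) y))).
  apply: le_Rintegral => //.
  - by apply: integrable_norm; exact: ifin.
  - exact: ifin (bounded_measurableD b1 b2).
  - by move=> y; rewrite /= in_itv/= => /andP[y0 _]; exact: bound.
have mB : fine (lebesgue_measure (`[0%R, B n]%classic : set R)) = B n.
  by rewrite lebesgue_measure_itv/= lte_fin B_gt0/= oppr0 addr0.
have mZ : fine (lebesgue_measure (`[0%R, Z]%classic : set R)) = Z.
  by rewrite lebesgue_measure_itv/= lte_fin Z0/= oppr0 addr0.
rewrite RintegralD//; [|exact: ifin _ b1|exact: ifin _ b2].
rewrite Rintegral_cst// mB RintegralZl//; last first.
  by apply: ifin; exact: bounded_measurable_indic.
rewrite [X in _ + _ * X](_ : _ = Z); last first.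
  transitivity (\int[lebesgue_measure]_(y in `[0, B n] `&` `[0, Z]) (1 : R)).
    rewrite [RHS]Rintegral_mkcondr; apply: eq_Rintegral => y _.
    by rewrite patchE indicE; case: ifP.
  rewrite (_ : _ `&` _ = `[0, Z]%classic) ?Rintegral_cst// ?mZ ?mul1r//.
  apply: setIidr => y /=; rewrite !in_itv/= => /andP[-> yZ].
  exact: le_trans BZ.
rewrite /xi (_ : K / B n * (e / (2 * K)) * B n = e / 2); last first.
  by field; rewrite !gt_eqF.
rewrite (_ : K / B n * Z * Z = (K * Z ^+ 2) / B n); last by field; rewrite gt_eqF.
rewrite [leRHS]splitr lerD2l ler_pdivrMr// -ler_pdivrMl ?divr_gt0//.
apply: le_trans (le_B n).
by near: n; exact: nbhs_infty_ger.
Unshelve. all: by end_near.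
Qed.

(** The frequency is [K] over the truncation level, so the tails, of order [c0]
    over that level, leave an error of order [c0 / K] that does not vanish with [n] but is
    small for large [K]. *)
Lemma sine_mean_near (K e : R) : 0 < K -> 0 < e ->
  \forall n \near \oo, `|(\int[mu]_x sin (K / n.+2%:R * x)) / (K / n.+2%:R) - gamma0|
    <= 4 * (c0 + 1) / K + e.
Proof.
move=> K0 e0.
have e2 : 0 < e / 2 by rewrite divr_gt0.
have /(@cvgrPdist_le _ R^o) /(_ _ e2) near1 := cvg_kernel K0.
have /(@cvgrPdist_le _ R^o) /(_ _ e2) near2 := cvg_clip.
have /(@cvgrPdist_le _ R^o) /(_ _ ltr01) near3 := cvg_right.
have /(@cvgrPdist_le _ R^o) /(_ _ ltr01) near4 := cvg_left.
near=> n.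
have x0 : 0 < K / n.+2%:R by rewrite divr_gt0.
have n1 : `|0 - \int[lebesgue_measure]_(y in `[0, B n])
    ((cos (xi K n * y) - 1) * tail_difference mu y)| <= e / 2 by near: n.
have n2 : `|gamma0 - \int[mu]_x clip (B n) x| <= e / 2 by near: n.
have n3 : `|c0 - B n * (1 - F (B n))| <= 1 by near: n.
have n4 : `|c0 - B n * F (- B n)| <= 1 by near: n.
have est := sine_mean_estimate mu x0 (B_gt0 n).
rewrite sub0r normrN in n1.
have tails : 2 * ((1 - F (B n)) + F (- B n)) / (K / n.+2%:R) <= 4 * (c0 + 1) / K.
  rewrite (_ : _ / (K / _) = 2 * (B n * (1 - F (B n)) + B n * F (- B n)) / K); last first.
    by rewrite /B; field; rewrite gt_eqF//= pnatr_eq0.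
  rewrite ler_wpM2r ?invr_ge0 ?(ltW K0)//.
  move: n3 n4; rewrite !ler_norml => /andP[a1 a2] /andP[a3 a4].
  set P1 := B n * _ in a1 a2 *; set P2 := B n * _ in a3 a4 *.
  lra.
rewrite (_ : _ - gamma0 = ((\int[mu]_x sin (K / n.+2%:R * x)) / (K / n.+2%:R) -
  \int[mu]_x clip (B n) x) - (gamma0 - \int[mu]_x clip (B n) x)); last by ring.
rewrite (le_trans (ler_normB _ _))// [X in _ <= _ + X]splitr addrA lerD//.
by rewrite (le_trans est)// addrC lerD.
Unshelve. all: by end_near.
Qed.

End sine_mean_limit.

Lemma Rintegral_marginal d (T : measurableType d) (R : realType)
    (m : probability T R) (q : T -> R) (mq : measurable_fun setT q)
    (mu : probability R R) (f : R -> R) :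
  (forall A, measurable A -> m (q @^-1` A) = mu A) -> bounded_measurable f ->
  \int[m]_z f (q z) = \int[mu]_x f x.
Proof.
move=> qmu bf; rewrite -(Rintegral_image m mq bf); congr fine.
by apply: eq_measure_integral => A mA _; exact: qmu.
Qed.

(** The differences [(sin (xi * z.1) - sin (xi * z.2)) / xi] are dominated by
    the integrable [`|z.1 - z.2|] and tend to [z.1 - z.2], while their means
    tend to [gamma0 - gamma0], up to an arbitrarily small error. *)
Lemma coupling_centered d (T : measurableType d) (R : realType)
    (P : probability T R) (L M : {RV P >-> R}) (nu muoo mu0 : probability R R)
    (c0 gamma0 p : R) (m : probability (R * R)%type R) :
  0 <= c0 ->
  `|x| * distribution_function mu0 x @[x --> -oo] --> c0 ->
  x * (1 - distribution_function mu0 x) @[x --> +oo] --> c0 ->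
  \int[mu0]_(x in `]- rho, rho[) x @[rho --> +oo] --> gamma0 ->
  mixing_measure L M nu ->
  steady_state nu c0 gamma0 muoo ->
  coupling mu0 muoo m -> 1 < p ->
  (\int[m]_z (`|z.1 - z.2| `^ p)%:E < +oo)%E ->
  \int[m]_z (z.1 - z.2) = 0.
Proof.
move=> c00 left right trunc mixing steady cpl p1 mp.
pose q (z : R * R) := z.1 - z.2.
have mq : measurable_fun setT q by apply: measurable_funB.
have i1 : m.-integrable setT (EFin \o (fun=> 1 : R)).
  exact: bounded_measurable_integrable (bounded_measurable_cst 1).
have ip : m.-integrable setT (EFin \o (fun z => `|q z| `^ p)).
  apply/integrableP; split; first exact: measurable_power_norm.
  by under eq_integral do rewrite /= ger0_norm ?powR_ge0//.
have iq : m.-integrable setT (EFin \o (fun z => `|q z|)).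
  apply: (@le_integrable _ _ _ m setT measurableT _
      (EFin \o (fun z => 1 + `|q z| `^ p))).
  - apply/measurable_EFinP; exact: measurableT_comp.
  - move=> z _; rewrite lee_fin normr_id [leRHS]ger0_norm ?addr_ge0 ?powR_ge0//.
    have [h|h] := lerP `|q z| 1; first by rewrite (le_trans h)// lerDl powR_ge0.
    by rewrite (le_trans (le1r_powR (ltW h) (ltW p1)))// lerDr.
  - exact: integrableD i1 ip.
have key (e : R) : 0 < e -> `|\int[m]_z q z| <= 4 * e.
  move=> e0.
  have K0 : 0 < 4 * (c0 + 1) / e by rewrite divr_gt0// mulr_gt0// ltr_wpDl.
  pose xi (n : nat) : R := 4 * (c0 + 1) / e / n.+2%:R.
  have xi0 n : 0 < xi n by rewrite divr_gt0.
  have xic : xi n @[n --> \oo] --> (0 : R).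
    rewrite -[X in _ --> X](mulr0 (4 * (c0 + 1) / e)).
    apply: cvgM; first exact: cvg_cst.
    by have := @cvg_harmonic R; rewrite -cvg_shiftS.
  have bs n : bounded_measurable (fun v : R => sin (xi n * v)).
    by apply: bounded_measurable_sin; exact: mulrl_measurable.
  pose g n (z : R * R) := (sin (xi n * z.1) - sin (xi n * z.2)) / xi n.
  have bs1 n := bounded_measurable_comp (@measurable_fst _ _ R R) (bs n).
  have bs2 n := bounded_measurable_comp (@measurable_snd _ _ R R) (bs n).
  have gE n : \int[m]_z g n z = (\int[mu0]_x sin (xi n * x)) / xi n -
      (\int[muoo]_v sin (xi n * v)) / xi n.
    rewrite -mulrBl RintegralZr//; last first.
      exact: (bounded_measurable_integrable m (bounded_measurableB (bs1 n) (bs2 n))).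
    rewrite RintegralB//; last 2 first.
    - exact: (bounded_measurable_integrable m (bs1 n)).
    - exact: (bounded_measurable_integrable m (bs2 n)).
    congr ((_ - _) / _).
      by apply: (Rintegral_marginal measurable_fst _ (bs n)) => A mA; have [] := cpl A mA.
    by apply: (Rintegral_marginal measurable_snd _ (bs n)) => A mA; have [] := cpl A mA.
  have mg n : measurable_fun setT (fun z => (g n z)%:E).
    apply/measurable_EFinP; apply: measurable_funM => //.
    by case: (bounded_measurableB (bs1 n) (bs2 n)).
  have gq : {ae m, forall z, setT z -> (g n z)%:E @[n --> \oo] --> (q z)%:E}.
    apply: aeW => z _; apply: cvg_EFin; first by near=> n.
    rewrite (_ : _ \o _ = (fun n => sin (xi n * z.1) / xi n - sin (xi n * z.2) / xi n)).
      by apply: cvgB; exact: cvg_sin_ratio.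
    by apply/funext => n; rewrite /= /g mulrBl.
  have gb : {ae m, forall z n, setT z -> (`|(g n z)%:E| <= (`|q z|)%:E)%E}.
    apply: aeW => z n _; rewrite /= lee_fin normrM normfV (gtr0_norm (xi0 n)).
    rewrite ler_pdivrMr// (le_trans (sin_lipschitz _ _))//.
    by rewrite -mulrBr normrM (gtr0_norm (xi0 n)) mulrC.
  have [ig _ H] := dominated_convergence measurableT mg
    ((measurable_EFinP _ _).2 mq) gq iq gb.
  have Hg : \int[m]_z g n z @[n --> \oo] --> \int[m]_z q z.
    by apply: fine_cvg; rewrite fineK//; exact: integrable_fin_num ig.
  have /(@cvgrPdist_le _ R^o) /(_ _ e0) near1 := Hg.
  have /(@cvgrPdist_le _ R^o) /(_ _ e0) near2 :=
    steady_sine_mean c00 mixing steady xi0 xic.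
  have near3 := sine_mean_near left right trunc K0 e0.
  near \oo => n.
  have n1 : `|\int[m]_z q z - \int[m]_z g n z| <= e by near: n.
  have n2 : `|gamma0 - (\int[muoo]_v sin (xi n * v)) / xi n| <= e by near: n.
  have n3 : `|(\int[mu0]_x sin (xi n * x)) / xi n - gamma0| <=
    4 * (c0 + 1) / (4 * (c0 + 1) / e) + e by near: n.
  have Ke : 4 * (c0 + 1) / (4 * (c0 + 1) / e) = e.
    by field; rewrite !gt_eqF//= ltr_wpDl.
  rewrite Ke in n3; rewrite gE in n1.
  move: n1 n2 n3; set a := _ / _; set b := (\int[muoo]_v _) / _.
  rewrite !ler_norml => /andP[? ?] /andP[? ?] /andP[? ?]; lra.
apply/eqP; rewrite -normr_le0; apply/ler_addgt0Pr => e e0; rewrite add0r.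
have e4 : 0 < e / 4 by rewrite divr_gt0.
by rewrite (le_trans (key _ e4))// mulrC divfK.
Unshelve. all: by end_near.
Qed.

(** * Exponential convergence *)

Section pair_collision.
Context d (T : measurableType d) (R : realType) (P : probability T R).
Variables (L M : {RV P >-> R}).

Definition pair_collision (z : T * ((R * R) * (R * R))) : R * R :=
  (L z.1 * z.2.1.1 + M z.1 * z.2.2.1, L z.1 * z.2.1.2 + M z.1 * z.2.2.2).

Lemma measurable_pair_collision : measurable_fun setT pair_collision.
Proof.
have mL : measurable_fun setT (fun z : T * ((R * R) * (R * R)) => L z.1).
  exact: measurableT_comp.
have mM : measurable_fun setT (fun z : T * ((R * R) * (R * R)) => M z.1).
  exact: measurableT_comp.
have m1 : measurable_fun setT (fun z : T * ((R * R) * (R * R)) => z.2.1).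
  exact: measurableT_comp.
have m2 : measurable_fun setT (fun z : T * ((R * R) * (R * R)) => z.2.2).
  exact: measurableT_comp.
apply: measurable_fun_pair; apply: measurable_funD; apply: measurable_funM => //.
- exact: (measurableT_comp measurable_fst m1).
- exact: (measurableT_comp measurable_fst m2).
- exact: (measurableT_comp measurable_snd m1).
- exact: (measurableT_comp measurable_snd m2).
Qed.

End pair_collision.

(** This lets the results on solutions apply to a fixed point of the collision
    operator. *)
Lemma kinetic_solution_cst d (T : measurableType d) (R : realType)
    (P : probability T R) (L M : {RV P >-> R}) (muoo : probability R R) :
  (forall xi, fourier_stieltjes muoo xi =
    Cexpectation P (fun w => fourier_stieltjes muoo (L w * xi) *
                             fourier_stieltjes muoo (M w * xi))) ->
  kinetic_solution L M muoo (fun=> muoo).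
Proof.
move=> fixed; split => [t xi t0|xi|//].
  rewrite -fixed subrr; split; exact: is_derive_cst.
by split; exact: cvg_cst.
Qed.

Section coupling_flow.
Context d (T : measurableType d) (R : realType) (P : probability T R).
Variables (L M : {RV P >-> R}) (mu0 muoo : probability R R).
Variables (mu : R -> probability R R) (m0 : probability (R * R)%type R).
Hypothesis kinetic : kinetic_solution L M mu0 mu.
Hypothesis fixed : forall xi, fourier_stieltjes muoo xi =
    Cexpectation P (fun w => fourier_stieltjes muoo (L w * xi) *
                             fourier_stieltjes muoo (M w * xi)).
Hypothesis cpl0 : coupling mu0 muoo m0.

(** Both marginals of this flow of laws on the plane solve the kinetic equation,
    the second one being stationary. *)
Definition coupling_flow (t : R) : probability (R * R)%type R :=
  mixture (geometric_weight t) (wild P (measurable_pair_collision L M) m0).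

Lemma coupling_flow_marginal (q : R * R -> R) (mq : measurable_fun setT q)
    (nu0 : probability R R) (nu : R -> probability R R) (t : R) :
  kinetic_solution L M nu0 nu ->
  (forall w x y, q (pair_collision L M (w, (x, y))) = L w * q x + M w * q y) ->
  (forall A, measurable A -> m0 (q @^-1` A) = nu0 A) ->
  0 <= t -> forall A, measurable A -> coupling_flow t (q @^-1` A) = nu t A.
Proof.
move=> kin qop q0 t0 A mA.
rewrite -(image_probabilityE (coupling_flow t) mq).
apply: fourier_stieltjes_inj => //.
rewrite /coupling_flow; apply: (fourier_geometric_mixture (mq := mq) kin) => //.
  by move=> xi; apply: eq_measure_Cintegral => B mB; exact: q0.
exact: fourier_wildS.
Qed.

Lemma coupling_coupling_flow (t : R) : 0 <= t ->
  coupling (mu t) muoo (coupling_flow t).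
Proof.
move=> t0 A mA; split.
  apply: (coupling_flow_marginal measurable_fst kinetic) => //.
  by move=> B mB; have [] := cpl0 mB.
apply: (coupling_flow_marginal measurable_snd (kinetic_solution_cst fixed)) => //.
by move=> B mB; have [] := cpl0 mB.
Qed.

(** At the base point 0 the excess bound is a bound on the moment. *)
Lemma coupling_flow_moment (p l r t : R) :
  1 < p -> p <= 2 -> 0 <= l -> 0 <= r ->
  (forall w, 0 <= L w) -> (forall w, 0 <= M w) ->
  (\int[P]_w (L w `^ p)%:E = l%:E)%E -> (\int[P]_w (M w `^ p)%:E = r%:E)%E ->
  (\int[m0]_z (`|z.1 - z.2| `^ p)%:E < +oo)%E -> \int[m0]_z (z.1 - z.2) = 0 ->
  0 <= t ->
  (\int[coupling_flow t]_z (`|z.1 - z.2| `^ p)%:E <=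
   (4 * \int[m0]_z (`|z.1 - z.2| `^ p) * expR (- (t * (1 - (l + r)))))%:E)%E.
Proof.
move=> p1 p2 l0 r0 L0 M0 El Er mp m00 t0.
have mq : measurable_fun setT (fun z : R * R => z.1 - z.2) by apply: measurable_funB.
have A00 : 0 <= 4 * \int[m0]_z (`|z.1 - z.2| `^ p).
  by rewrite mulr_ge0// Rintegral_ge0.
have qop w x y : (fun z : R * R => z.1 - z.2) (pair_collision L M (w, (x, y))) =
    L w * (x.1 - x.2) + M w * (y.1 - y.2).
  by rewrite /pair_collision/=; ring.
have ex0 := moment_excess_centered p1 p2 mq mp m00.
have exn := moment_excess_wild (measurable_pair_collision L M) A00 l0 r0 p1 mq
  (measurable_funPT L) (measurable_funPT M) L0 M0 qop El Er ex0.
have := moment_excess_mixture mq (geometric_weight_sum1 t0) exn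
  (fun N => sum_geometric_wild_moment N A00 l0 r0 t0) 0.
rewrite normr0 powR0 ?add0r; last by rewrite gt_eqF//; lra.
by under eq_integral do rewrite add0r.
Qed.

End coupling_flow.

Theorem theorem3p2 (R : realType) (d : measure_display) (T : measurableType d)
    (P : probability T R) (L M : {RV P >-> R}) (p : R)
    (mu0 : probability R R) (c0 gamma0 : R)
    (mu : R -> probability R R) (nu1 muoo : probability R R) :
  1 < p -> p <= 2 ->
  (forall w, 0 <= L w) -> (forall w, 0 <= M w) ->
  (1 < P [set w | 0 < L w]%R + P [set w | 0 < M w]%R)%E ->
  ('E_P[(fun w => L w + M w)%R] = 1)%E ->
  ('E_P[(fun w => L w `^ p + M w `^ p)%R] < 1)%E ->
  0 <= c0 ->
  `|x| * distribution_function mu0 x @[x --> -oo] --> c0 ->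
  x * (1 - distribution_function mu0 x) @[x --> +oo] --> c0 ->
  \int[mu0]_(x in `]- rho, rho[) x @[rho --> +oo] --> gamma0 ->
  kinetic_solution L M mu0 mu ->
  mixing_measure L M nu1 ->
  steady_state nu1 c0 gamma0 muoo ->
  (wasserstein p mu0 muoo < +oo)%E ->
  exists C : R, forall t : R, 0 <= t ->
    (wasserstein p (mu t) muoo <=
       C%:E * expeR (- (t%:E * `|spectral_function L M p|)))%E.
Proof.
move=> p1 p2 L0 M0 _ _ ELM c00 left_tail right_tail truncated_mean kinetic mixing
  steady /ereal_inf_lt[_ [m0 /= cpl0 <-] m0p].
have p0 : 0 < p by lra.
have pV : Num.min 1 p^-1 = p^-1 by rewrite min_r// invf_le1// ltW.
rewrite pV in m0p.
have {}m0p : (\int[m0]_z (`|z.1 - z.2| `^ p)%:E < +oo)%E.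
  by apply: lty_poweRy m0p; rewrite invr_eq0 gt_eqF.
have mp (X : {RV P >-> R}) : measurable_fun setT (fun w => (X w `^ p)%:E).
  apply/measurable_EFinP.
  exact: measurableT_comp (measurable_powR p) (measurable_funPT X).
have ge0 (X : {RV P >-> R}) : (0 <= \int[P]_w (X w `^ p)%:E)%E.
  by apply: integral_ge0 => w _; rewrite lee_fin powR_ge0.
have ELME : ('E_P[(fun w => L w `^ p + M w `^ p)%R] =
    \int[P]_w (L w `^ p)%:E + \int[P]_w (M w `^ p)%:E)%E.
  rewrite unlock -ge0_integralD//; try by move=> w _; rewrite lee_fin powR_ge0.
have [l El] : exists l, (\int[P]_w (L w `^ p)%:E = l%:E)%E.
  exists (fine (\int[P]_w (L w `^ p)%:E)%E); rewrite fineK// ge0_fin_numE//.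
  rewrite (@le_lt_trans _ _ ('E_P[(fun w => L w `^ p + M w `^ p)%R])%E)//.
    by rewrite ELME leeDl.
  by rewrite (lt_trans ELM)// ltry.
have [r Er] : exists r, (\int[P]_w (M w `^ p)%:E = r%:E)%E.
  exists (fine (\int[P]_w (M w `^ p)%:E)%E); rewrite fineK// ge0_fin_numE//.
  rewrite (@le_lt_trans _ _ ('E_P[(fun w => L w `^ p + M w `^ p)%R])%E)//.
    by rewrite ELME leeDr.
  by rewrite (lt_trans ELM)// ltry.
have l0 : 0 <= l by rewrite -lee_fin -El.
have r0 : 0 <= r by rewrite -lee_fin -Er.
rewrite ELME El Er -EFinD lte_fin in ELM.
have fixed := steady_collision L0 M0 c00 mixing steady.
have m00 := coupling_centered c00 left_tail right_tail truncated_mean mixing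
  steady cpl0 p1 m0p.
set A := 4 * \int[m0]_z (`|z.1 - z.2| `^ p).
have A0 : 0 <= A by rewrite mulr_ge0// Rintegral_ge0.
exists (A `^ p^-1) => t t0.
apply: (@le_trans _ _ ((\int[coupling_flow L M m0 t]_z
    (`|z.1 - z.2| `^ p)%:E) `^ (Num.min 1 p^-1)%R)%E).
  apply: ereal_inf_lbound; exists (coupling_flow L M m0 t) => //.
  exact: coupling_coupling_flow kinetic fixed cpl0 t t0.
rewrite pV.
have flow := coupling_flow_moment p1 p2 l0 r0 L0 M0 El Er m0p m00 t0.
apply: (@le_trans _ _ ((A * expR (- (t * (1 - (l + r)))))%:E `^ p^-1)%E).
  apply: gt0_ler_poweR => //; first by rewrite invr_ge0 ltW.
  - rewrite in_itv/= leey andbT; apply: integral_ge0 => z _.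
    by rewrite lee_fin powR_ge0.
  - by rewrite in_itv/= leey andbT lee_fin mulr_ge0// expR_ge0.
have -> : spectral_function L M p = (p^-1 * (l + r - 1))%:E.
  by rewrite /spectral_function ELME El Er.
rewrite poweR_EFin /= -EFinM lee_fin powRM ?expR_ge0// -expRM.
rewrite ler0_norm; last first.
  by rewrite mulr_ge0_le0// ?invr_ge0 ?(ltW p0)// subr_le0 ltW.
rewrite le_eqVlt; apply/orP; left; apply/eqP; congr (_ * expR _).
by ring.
Qed.
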